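(* For each oriented virtual knot diagram $K$ and each real crossing point $c$ of $K$, let $\widetilde{L}_c=F(L_c)$ be the oriented (unordered) 2-component flat virtual link represented by the shadow of the diagram $L_c$ obtained from $K$ by $1$-smoothing at $c$. Then the assignment $c\mapsto \widetilde{L}_c$ satisfies the chord index axioms, i.e.: (1) the real crossing point involved in an $\Omega_1$ move has a fixed index (an index depending only on the virtual knot represented by the diagram); (2) the two real crossing points involved in an $\Omega_2$ move have the same index; (3) the indices of the three real crossing points involved in an $\Omega_3$ move are respectively preserved under $\Omega_3$; (4) the index of the real crossing point involved in an $\Omega_3^v$ move is preserved under $\Omega_3^v$; (5) the index of any real crossing point not involved in a generalized Reidemeister move is preserved under this move.
   Context: A virtual knot (link) diagram is a generic immersed circle (collection of circles) in the plane with finitely many transversal double points, each double point being marked either as a real crossing (with over/under information) or as a virtual crossing. The generalized Reidemeister moves are: the classical Reidemeister moves $\Omega_1,\Omega_2,\Omega_3$ on real crossings; the moves $\Omega_1',\Omega_2',\Omega_3'$, which have the same shapes but with all crossings virtual; and $\Omega_3^v$, a third-Reidemeister-type move in which an arc having only two virtual crossings is moved across one real crossing. A virtual knot (link) is an equivalence class of diagrams under these moves (and planar isotopy). A flat virtual knot (link) diagram is defined in the same way, with each real crossing replaced by a flat crossing (no over/under information). The flat generalized Reidemeister moves are obtained from the generalized Reidemeister moves $\Omega_1,\Omega_2,\Omega_3,\Omega_1',\Omega_2',\Omega_3',\Omega_3^v$ by replacing all real crossings with flat crossings. Flat virtual knots (links) are equivalence classes of flat virtual knot (link) diagrams under the flat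 generalized Reidemeister moves. The shadow $F(D)$ of a virtual diagram $D$ is the flat diagram obtained by replacing every real crossing with a flat crossing. A real crossing $c$ of an oriented virtual knot diagram $K$ has two resolutions (replacing a neighbourhood of the crossing by two disjoint arcs). The $1$-smoothing is the one which does not preserve the number of components, i.e. the orientation-compatible one. It gives an oriented 2-component virtual link diagram $L_c$. The two components of $\widetilde{L}_c$ are unordered. In (3), crossings before and after the $\Omega_3$ move correspond if they are crossings between the same two of the three strands. ''Index'' means $\widetilde{L}_c$, considered as an oriented unordered 2-component flat virtual link (equivalence class). *)

(* Defs.v *)
From Stdlib Require Export Relation_Operators.
From mathcomp Require Export all_boot.

Set Implicit Arguments.
Unset Strict Implicit.
Unset Printing Implicit Defensive.

(* Plane diagrams in Morse form.  A generic diagram in the plane, with the    *)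
(* height function in general position, is the word of its critical levels    *)
(* (minima, maxima, double points), read upwards.  Two words describe planar  *)
(* isotopic diagrams iff they are related by the Isotopy rules below, as in   *)
(* the presentation by generators and relations of the category of oriented   *)
(* planar tangles.                                                            *)
(*                                                                            *)
(* (i, e) is the elementary diagram e whose leftmost strand is strand number  *)
(* i, counted from the left starting at 0, all other strands being vertical.  *)
Inductive elem (X : Type) :=
  | Cup of bool  (* minimum; the boolean orients its left leg, true is upwards *)
  | Cap          (* maximum *)
  | Cross of X.  (* double point *)
Arguments Cup {X}.
Arguments Cap {X}.

Definition word (X : Type) := seq (nat * elem X).

(* Real true: the strand going from bottom left to top right passes over.     *)
Inductive vcrossing := Real of bool | Virtual.
Inductive fcrossing := Flat | FVirtual.

Definition vword := word vcrossing.
Definition fword := word fcrossing.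

Section Words.
Variable X : Type.
Implicit Types (w : word X) (s : seq bool).

(* The state at a regular level lists the directions (true is upwards) of the *)
(* strands that cross this level, from left to right.                         *)
Definition step s (g : nat * elem X) : option (seq bool) :=
  let i := g.1 in
  match g.2 with
  | Cup b =>
      if i <= size s then Some (take i s ++ [:: b, ~~ b & drop i s]) else None
  | Cap =>
      if drop i s is [:: a, b & t] then
        if a != b then Some (take i s ++ t) else None
      else None
  | Cross _ =>
      if drop i s is [:: a, b & t] then Some (take i s ++ [:: b, a & t])
      else None
  end.

Fixpoint run s w : option (seq bool) :=
  if w is g :: w' then
    if step s g is Some s' then run s' w' else None
  else Some s.

Definition diagram w : bool := run [::] w == Some [::].

(* Upward sweep computing the number of components.  In (ls, n, k), ls gives  *)
(* the strands at the current level labels such that two of them are equal    *)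
(* iff the strands are joined below that level, n is a fresh label, and k is  *)
(* the number of components that lie entirely below.                          *)
Definition trace_step (st : seq nat * nat * nat) (g : nat * elem X) :=
  let: (ls, n, k) := st in
  let i := g.1 in
  match g.2 with
  | Cup _ => (take i ls ++ [:: n, n & drop i ls], n.+1, k)
  | Cap =>
      let a := nth 0 ls i in
      let b := nth 0 ls i.+1 in
      let ls' := take i ls ++ drop i.+2 ls in
      if a == b then (ls', n, k.+1)
      else ([seq (if c == a then b else c) | c <- ls'], n, k)
  | Cross _ =>
      (take i ls ++ [:: nth 0 ls i.+1, nth 0 ls i & drop i.+2 ls], n, k)
  end.

Definition components w : nat := (foldl trace_step ([::], 0, 0) w).2.

Definition strands_in (e : elem X) : nat := if e is Cup _ then 0 else 2.
Definition strands_out (e : elem X) : nat := if e is Cap then 0 else 2.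

End Words.

Definition knot (K : vword) : bool := diagram K && (components K == 1).

Definition is_real (x : vcrossing) : bool := if x is Real _ then true else false.

Definition real_crossing (K : vword) (c : nat) : bool :=
  if onth K c is Some (_, Cross x) then is_real x else false.

(* Sliding a crossing along one of its strands through an extremum turns it   *)
(* by a quarter.                                                              *)
Definition turn (x : vcrossing) : vcrossing :=
  if x is Real o then Real (~~ o) else Virtual.

Inductive kind :=
  | Isotopy
  | Omega1 | Omega2 | Omega3
  | Omega1' | Omega2' | Omega3'
  | Omega3v.

(* The two sides of a third move on strands p, q, r, numbered from the left   *)
(* at the bottom, with given crossings pq, pr, qr.  In each of these, the     *)
(* strand named first goes from bottom left to top right.                     *)
Definition third_lhs i (pq pr qr : vcrossing) : vword :=
  [:: (i, Cross pq); (i.+1, Cross pr); (i, Cross qr)].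
Definition third_rhs i (pq pr qr : vcrossing) : vword :=
  [:: (i.+1, Cross qr); (i, Cross pr); (i.+1, Cross pq)].
Definition third_corr : seq (nat * nat) := [:: (0, 2); (1, 1); (2, 0)].

(* The over/under relation on the three strands is not cyclic, so that they   *)
(* can be put at three different heights.                                     *)
Definition layered (pq pr qr : bool) : bool := (pq == qr) ==> (pr == pq).

(* local_move k l r m: the word l can be replaced by r in a move of kind k;   *)
(* m lists the pairs of positions of corresponding letters of l and r.  Other *)
(* positions of these moves in the plane, such as kinks on a vertical strand, *)
(* follow by planar isotopy; orientations are carried by the states.          *)
Inductive local_move : kind -> vword -> vword -> seq (nat * nat) -> Prop :=
  | iso_exchange i j e f :
      local_move Isotopy
        [:: (i, e); (i + strands_out e + j, f)]
        [:: (i + strands_in e + j, f); (i, e)] [:: (0, 1); (1, 0)]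
  | iso_zigzag_l i b :
      local_move Isotopy [:: (i.+1, Cup b); (i, Cap)] [::] [::]
  | iso_zigzag_r i b :
      local_move Isotopy [:: (i, Cup b); (i.+1, Cap)] [::] [::]
  | iso_cup i b x :
      local_move Isotopy
        [:: (i, Cup b); (i.+1, Cross x)]
        [:: (i.+1, Cup b); (i, Cross (turn x))] [:: (1, 1)]
  | iso_cap i x :
      local_move Isotopy
        [:: (i.+1, Cross x); (i, Cap)]
        [:: (i, Cross (turn x)); (i.+1, Cap)] [:: (0, 0)]
  | omega1_cup i b o :
      local_move Omega1
        [:: (i, Cup b); (i, Cross (Real o))] [:: (i, Cup (~~ b))] [::]
  | omega1_cap i o :
      local_move Omega1 [:: (i, Cross (Real o)); (i, Cap)] [:: (i, Cap)] [::]
  | omega2 i o :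
      local_move Omega2
        [:: (i, Cross (Real o)); (i, Cross (Real (~~ o)))] [::] [::]
  | omega3 i pq pr qr of layered pq pr qr :
      local_move Omega3
        (third_lhs i (Real pq) (Real pr) (Real qr))
        (third_rhs i (Real pq) (Real pr) (Real qr)) third_corr
  | omega1'_cup i b :
      local_move Omega1'
        [:: (i, Cup b); (i, Cross Virtual)] [:: (i, Cup (~~ b))] [::]
  | omega1'_cap i :
      local_move Omega1' [:: (i, Cross Virtual); (i, Cap)] [:: (i, Cap)] [::]
  | omega2' i :
      local_move Omega2' [:: (i, Cross Virtual); (i, Cross Virtual)] [::] [::]
  | omega3' i :
      local_move Omega3'
        (third_lhs i Virtual Virtual Virtual)
        (third_rhs i Virtual Virtual Virtual) third_corr
  | omega3v i x y z of count is_real [:: x; y; z] == 1 :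
      local_move Omega3v (third_lhs i x y z) (third_rhs i x y z) third_corr.

Record move := Move {
  mkind : kind;
  pre : vword;
  lhs : vword;
  rhs : vword;
  post : vword;
  corr : seq (nat * nat) }.

Definition source (M : move) : vword := pre M ++ lhs M ++ post M.
Definition target (M : move) : vword := pre M ++ rhs M ++ post M.

Definition valid (M : move) : Prop :=
  [/\ local_move (mkind M) (lhs M) (rhs M) (corr M),
      diagram (source M) & diagram (target M)].

Definition involved (M : move) (c : nat) : bool :=
  size (pre M) <= c < size (pre M) + size (lhs M).

Inductive corresponds (M : move) : nat -> nat -> Prop :=
  | corr_pre c of c < size (pre M) : corresponds M c c
  | corr_in p q of (p, q) \in corr M :
      corresponds M (size (pre M) + p) (size (pre M) + q)
  | corr_post j :
      corresponds M (size (pre M) + size (lhs M) + j)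
                    (size (pre M) + size (rhs M) + j).

Definition vstep (K K' : vword) : Prop :=
  exists M, [/\ valid M, source M = K & target M = K'].

Definition virtual_equiv : vword -> vword -> Prop := clos_refl_sym_trans _ vstep.

Definition flatten_elem (e : elem vcrossing) : elem fcrossing :=
  match e with
  | Cup b => Cup b
  | Cap => Cap
  | Cross (Real _) => Cross Flat
  | Cross Virtual => Cross FVirtual
  end.

Definition shadow (K : vword) : fword := [seq (g.1, flatten_elem g.2) | g <- K].

Definition fstep (D D' : fword) : Prop :=
  exists M, [/\ valid M, shadow (source M) = D & shadow (target M) = D'].

(* Components carry no order, so on 2-component diagrams this is the          *)
(* equivalence of oriented unordered 2-component flat virtual links.          *)
Definition flat_equiv : fword -> fword -> Prop := clos_refl_sym_trans _ fstep.

(* Orientation-compatible smoothing of a crossing at strands i, i.+1, where s *)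
(* is the state just below: two vertical strands if their directions agree, a *)
(* maximum below a minimum otherwise.                                         *)
Definition smoothing (s : seq bool) (i : nat) : vword :=
  if nth true s i == nth true s i.+1 then [::]
  else [:: (i, Cap); (i, Cup (nth true s i.+1))].

Definition smooth (K : vword) (c : nat) : vword :=
  take c K ++
  smoothing (odflt [::] (run [::] (take c K))) (nth (0, Cap) K c).1 ++
  drop c.+1 K.

Definition shadow_index (K : vword) (c : nat) : fword := shadow (smooth K c).

(* The values of an index are points of I up to eqI.  Since words describe    *)
(* diagrams only up to planar isotopy, invariance under the latter is stated  *)
(* as well.                                                                   *)
Record chord_index_axioms (I : Type) (eqI : I -> I -> Prop)
    (idx : vword -> nat -> I) : Prop := {
  index_omega1 :
    exists fixed : vword -> I,
      (forall K K', knot K -> knot K' -> virtual_equiv K K' ->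
         eqI (fixed K) (fixed K')) /\
      (forall M c, valid M -> knot (source M) -> mkind M = Omega1 ->
         involved M c -> real_crossing (source M) c ->
         eqI (idx (source M) c) (fixed (source M)));
  index_omega2 :
    forall M c c', valid M -> knot (source M) -> mkind M = Omega2 ->
      involved M c -> involved M c' ->
      eqI (idx (source M) c) (idx (source M) c');
  index_omega3 :
    forall M c c', valid M -> knot (source M) -> mkind M = Omega3 ->
      involved M c -> corresponds M c c' ->
      eqI (idx (source M) c) (idx (target M) c');
  index_omega3v :
    forall M c c', valid M -> knot (source M) -> mkind M = Omega3v ->
      involved M c -> real_crossing (source M) c -> corresponds M c c' ->
      eqI (idx (source M) c) (idx (target M) c');
  index_not_involved :
    forall M c c', valid M -> knot (source M) ->
      ~~ involved M c -> real_crossing (source M) c -> corresponds M c c' ->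
      eqI (idx (source M) c) (idx (target M) c');
  index_isotopy :
    forall M c c', valid M -> knot (source M) -> mkind M = Isotopy ->
      real_crossing (source M) c -> corresponds M c c' ->
      eqI (idx (source M) c) (idx (target M) c') }.

(* Main.v *)
(* Moves.  Smoothing the crossings that correspond under a move turns the     *)
(* move into flat moves.  When both strands are parallel at the smoothed      *)
(* crossing, the two diagrams differ by at most a second move; otherwise the  *)
(* smoothing is a cap below a cup, and the remaining strand slides over one   *)
(* of them.  A kink smooths to a small circle next to the unkinked diagram;   *)
(* in the flat virtual world that circle can be pulled through everything and *)
(* reversed, so the index of a kink is the shadow of the knot with a split    *)
(* circle.                                                                    *)
(*                                                                            *)
(* Components.  Below a level, each upward strand is joined to a downward     *)
(* one; call sg this bijection.  The smoothed and unsmoothed diagrams give    *)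
(* bijections that initially differ by a transposition (or agree, with one    *)
(* more closed component).  Sweeping the common rest of the diagrams keeps    *)
(* this until a cap closes a component in one of them only, after which the   *)
(* bijections agree.  So the numbers of components differ by one, and one     *)
(* component becomes two since none is impossible.                            *)

(* The comparison of indices is local. A word is cut just below and just above a move, and
   [flat_local s t l r] compares the two tangles in between inside every closing context. Smoothing
   a crossing preserves the bottom and top states of any piece that contains it ([run_smooth_from]).
   Hence smoothing a crossing outside a move only changes the context of that move
   ([valid_context]), and a pair of corresponding crossings inside it is handled by the case
   analysis of [local_move_smooth]. Together these give [index_corresponds], from which (3), (4),
   (5) and invariance under planar isotopy follow.

   For (2), if the strands of the bigon are parallel, each smoothing leaves one crossing, and the
   two differ only in over/under data; if they are antiparallel, each smoothing leaves a kink that a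
   flat first move removes ([smooth_double]). For (1), the circle split off by a kink is carried to
   the top left corner with a standard orientation ([circle_top], [smooth_kink]). The resulting
   diagram depends on the knot only, by [add_circle_equiv].

   That a smoothed knot has exactly two components is a separate argument ([components_smoothing]):
   both diagrams are swept simultaneously with the same strand names, [traced] relating labels to
   joining bijections and [paired] relating the two bijections. *)
Require Import Defs.
From mathcomp Require Import zify.

Set Implicit Arguments.
Unset Strict Implicit.
Unset Printing Implicit Defensive.

Arguments step {X} s g : simpl never.

(** * Running words *)

Section Runs.
Variable X : Type.
Implicit Types (u v w : word X) (s t : seq bool) (e : elem X).

Lemma run_cat s t u v : run s u = Some t -> run s (u ++ v) = run t v.
Proof.
elim: u s => [|g u IHu] s /=; first by case=> ->.
by case: (step s g) => // s1; apply: IHu.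
Qed.

Lemma run_catP s u v r :
  run s (u ++ v) = Some r -> exists2 t, run s u = Some t & run t v = Some r.
Proof.
elim: u s => [|g u IHu] s /=; first by move=> h; exists s.
by case: (step s g) => // s1; apply: IHu.
Qed.

Lemma step_cup (A C : seq bool) b :
  step (A ++ C) (size A, Cup b : elem X) = Some (A ++ [:: b, ~~ b & C]).
Proof.
by rewrite /step /= size_cat leq_addr take_size_cat // drop_size_cat.
Qed.

Lemma step_cap (A C : seq bool) a b :
  step (A ++ [:: a, b & C]) (size A, Cap : elem X) =
    if a != b then Some (A ++ C) else None.
Proof. by rewrite /step /= take_size_cat // drop_size_cat. Qed.

Lemma step_cross (A C : seq bool) a b (x : X) :
  step (A ++ [:: a, b & C]) (size A, Cross x) = Some (A ++ [:: b, a & C]).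
Proof. by rewrite /step /= take_size_cat // drop_size_cat. Qed.

Lemma step_cup1 (A C : seq bool) d b :
  step (A ++ d :: C) ((size A).+1, Cup b : elem X) =
    Some (A ++ [:: d, b, ~~ b & C]).
Proof. by rewrite -cat_rcons -(size_rcons A d) step_cup cat_rcons. Qed.

Lemma step_cap1 (A C : seq bool) d a b :
  step (A ++ [:: d, a, b & C]) ((size A).+1, Cap : elem X) =
    if a != b then Some (A ++ d :: C) else None.
Proof. by rewrite -cat_rcons -(size_rcons A d) step_cap cat_rcons. Qed.

Lemma step_cross1 (A C : seq bool) d a b (x : X) :
  step (A ++ [:: d, a, b & C]) ((size A).+1, Cross x) =
    Some (A ++ [:: d, b, a & C]).
Proof. by rewrite -cat_rcons -(size_rcons A d) step_cross cat_rcons. Qed.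

Lemma step_local A P P' C e :
  size P = strands_in e -> step P (0, e) = Some P' ->
  step (A ++ P ++ C) (size A, e) = Some (A ++ P' ++ C).
Proof.
case: e => [b||x]; case: P => [|a [|a' [|//]]] //= _.
- by case=> <-; rewrite step_cup.
- by rewrite step_cap (step_cap [::] [::]) /=; case: ifP => // _ [<-].
- by rewrite (step_cross [::] [::]) step_cross => -[<-].
Qed.

Lemma stepP s i e t :
  step s (i, e) = Some t ->
  exists A P P' C, [/\ s = A ++ P ++ C, t = A ++ P' ++ C, size A = i,
    size P = strands_in e & step P (0, e) = Some P'].
Proof.
rewrite -{1 2}(cat_take_drop i s); case: e => [b||x].
- rewrite {1}/step /= cat_take_drop; case: ifP => // le_is -[<-].
  exists (take i s), [::], [:: b; ~~ b], (drop i s).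
  by split; rewrite ?cat_take_drop ?size_takel.
- case ds: (drop i s) => [|a [|a' C]];
    try by rewrite -ds cat_take_drop /step /= ds.
  have si : size (take i s) = i.
    by move: (congr1 size ds); rewrite size_drop size_take /=; case: ltnP; lia.
  rewrite -{2}si step_cap; case: ifP => // aa' [<-].
  exists (take i s), [:: a; a'], [::], C; split=> //.
  by rewrite (step_cap [::] [::]) aa'.
- case ds: (drop i s) => [|a [|a' C]];
    try by rewrite -ds cat_take_drop /step /= ds.
  have si : size (take i s) = i.
    by move: (congr1 size ds); rewrite size_drop size_take /=; case: ltnP; lia.
  rewrite -{2}si step_cross => -[<-].
  by exists (take i s), [:: a; a'], [:: a'; a], C; split=> //.
Qed.

Lemma step_bound s (g : nat * elem X) t :
  step s g = Some t -> g.1 + strands_in g.2 <= size s.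
Proof.
case: g => i e /stepP[A] [P] [P'] [C] [-> _ <- <- _] /=.
by rewrite !size_cat addnA leq_addr.
Qed.

Lemma size_step s (g : nat * elem X) t :
  step s g = Some t -> size t + strands_in g.2 = size s + strands_out g.2.
Proof.
case: g => i e /stepP[A] [P] [P'] [C] [-> -> _ sP] /= h.
rewrite !size_cat -sP; suff: size P' = strands_out e by lia.
move: sP h; case: e => [b||x]; case: P => [|a [|a' [|//]]] //= _;
  rewrite /step /=.
- by case=> <-.
- by case: ifP => // _ [<-].
- by case=> <-.
Qed.

End Runs.

Lemma cat_split (T : Type) (s : seq T) i k : i + k <= size s ->
  exists A B C, [/\ s = A ++ B ++ C, size A = i & size B = k].
Proof.
move=> le_s; exists (take i s), (take k (drop i s)), (drop k (drop i s)).
by rewrite !cat_take_drop; split; rewrite ?size_takel ?size_drop //; lia.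
Qed.

Lemma split0 (T : Type) (s : seq T) i : i <= size s ->
  exists A C, s = A ++ C /\ size A = i.
Proof.
by exists (take i s), (drop i s); rewrite cat_take_drop size_takel.
Qed.

Lemma split1 (T : Type) (s : seq T) i : i < size s ->
  exists A a C, s = A ++ a :: C /\ size A = i.
Proof.
rewrite -addn1 => /cat_split[A [B [C [-> <-]]]]; case: B => [|a [|//]] // _.
by exists A, a, C.
Qed.

Lemma split2 (T : Type) (s : seq T) i : i.+1 < size s ->
  exists A a b C, s = A ++ [:: a, b & C] /\ size A = i.
Proof.
rewrite -addn2 => /cat_split[A [B [C [-> <-]]]].
case: B => [|a [|b [|//]]] // _.
by exists A, a, b, C.
Qed.

Lemma split3 (T : Type) (s : seq T) i : i.+2 < size s ->
  exists A a b c C, s = A ++ [:: a, b, c & C] /\ size A = i.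
Proof.
rewrite -addn3 => /cat_split[A [B [C [-> <-]]]].
case: B => [|a [|b [|c [|//]]]] // _.
by exists A, a, b, c, C.
Qed.

Definition stepE := (step_cup, step_cup1, step_cap, step_cap1, step_cross,
  step_cross1).

(** * Flat equivalence of words in context *)

Lemma strands_in_flatten e : strands_in (flatten_elem e) = strands_in e.
Proof. by case: e => [||[]]. Qed.

Lemma strands_out_flatten e : strands_out (flatten_elem e) = strands_out e.
Proof. by case: e => [||[]]. Qed.

Lemma step_flatten s i e : step s (i, flatten_elem e) = step s (i, e).
Proof. by case: e => [||[]]. Qed.

Lemma run_shadow s w : run s (shadow w) = run s w.
Proof.
by elim: w s => //= -[i e] w IHw s; rewrite step_flatten; case: (step s _).
Qed.

Lemma shadow_cat u v : shadow (u ++ v) = shadow u ++ shadow v.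
Proof. exact: map_cat. Qed.

(** A section of the shadow map. Flat moves are shadows of virtual moves, so a flat context must be
    lifted before a move can be performed in it; since the context is left untouched, any choice of
    over/under data will do. *)
Definition lift_elem (e : elem fcrossing) : elem vcrossing :=
  match e with
  | Cup b => Cup b
  | Cap => Cap
  | Cross Flat => Cross (Real true)
  | Cross FVirtual => Cross Virtual
  end.

Definition lift (w : fword) : vword := [seq (g.1, lift_elem g.2) | g <- w].

Lemma lift_elemK : cancel lift_elem flatten_elem.
Proof. by case=> [||[]]. Qed.

Lemma liftK : cancel lift shadow.
Proof.
by elim=> //= -[i e] w ->; rewrite lift_elemK.
Qed.

Lemma run_lift s w : run s (lift w) = run s w.
Proof. by rewrite -run_shadow liftK. Qed.

(** Flat equivalence concerns closed diagrams, so open tangles are compared in all contexts that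
    close them. Fixing the end states [s] and [t] makes the relation stable under composition. *)
Definition flat_local s t (l r : fword) : Prop :=
  [/\ run s l = Some t, run s r = Some t &
    forall pre post, run [::] pre = Some s -> run t post = Some [::] ->
      flat_equiv (pre ++ l ++ post) (pre ++ r ++ post)].

Section FlatLocal.
Implicit Types (s t : seq bool) (l r w : fword).

Lemma floc_refl s t w : run s w = Some t -> flat_local s t w w.
Proof. by move=> ?; split=> // *; apply: rst_refl. Qed.

Lemma floc_sym s t l r : flat_local s t l r -> flat_local s t r l.
Proof. by case=> ? ? h; split=> // *; apply/rst_sym/h. Qed.

Lemma floc_trans w s t l r :
  flat_local s t l w -> flat_local s t w r -> flat_local s t l r.
Proof.
move=> [? ? h1] [? ? h2]; split=> // pre post hp hq.
exact: rst_trans (h1 _ _ hp hq) (h2 _ _ hp hq).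
Qed.

Lemma floc_ctx a b s s' t t' l r :
  flat_local s' t' l r -> run s a = Some s' -> run t' b = Some t ->
  flat_local s t (a ++ l ++ b) (a ++ r ++ b).
Proof.
move=> [rl rr h] ra rb; split;
  try by rewrite (run_cat _ ra) (run_cat _ rl, run_cat _ rr).
move=> pre post hp hq; rewrite -!catA !(catA pre).
by apply: h; rewrite ?(run_cat _ hp) ?(run_cat _ rb).
Qed.

Lemma floc_prefix a s s' t l r :
  flat_local s' t l r -> run s a = Some s' -> flat_local s t (a ++ l) (a ++ r).
Proof.
by move=> lr ra; have := floc_ctx (b := [::]) lr ra erefl; rewrite !cats0.
Qed.

Lemma floc_move k vl vr m s t : local_move k vl vr m ->
  run s (shadow vl) = Some t -> run s (shadow vr) = Some t ->
  flat_local s t (shadow vl) (shadow vr).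
Proof.
move=> mv rl rr; split=> // pre post hp hq; apply: rst_step.
exists (Move k (lift pre) vl vr (lift post) m).
rewrite /source /target /= !shadow_cat !liftK; split=> //; split=> //=.
  rewrite /diagram /source /= (run_cat (t := s)) ?run_lift //.
  by rewrite (run_cat (t := t)) ?run_lift -?run_shadow ?hq.
rewrite /diagram /source /= (run_cat (t := s)) ?run_lift //.
by rewrite (run_cat (t := t)) ?run_lift -?run_shadow ?hq.
Qed.

Lemma floc_zigzag_l A d C :
  flat_local (A ++ d :: C) (A ++ d :: C)
    [:: ((size A).+1, Cup (~~ d)); (size A, Cap)] [::].
Proof.
by apply: (floc_move (iso_zigzag_l (size A) (~~ d)));
  rewrite /= ?stepE /= ?negbK; case: d.
Qed.

Lemma floc_zigzag_r A d C :
  flat_local (A ++ d :: C) (A ++ d :: C)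
    [:: (size A, Cup d); ((size A).+1, Cap)] [::].
Proof.
by apply: (floc_move (iso_zigzag_r (size A) d)); rewrite /= ?stepE /=; case: d.
Qed.

(** The same [x] occurs on both sides because [turn] only alters over/under data, which the shadow
    forgets. *)
Lemma floc_cup_cross A d b C x :
  flat_local (A ++ d :: C) (A ++ [:: b, d, ~~ b & C])
    [:: (size A, Cup b); ((size A).+1, Cross x)]
    [:: ((size A).+1, Cup b); (size A, Cross x)].
Proof.
by case: x; [apply: (floc_move (iso_cup (size A) b (Real true)))
  | apply: (floc_move (iso_cup (size A) b Virtual))]; rewrite /= ?stepE.
Qed.

Lemma floc_cross_cap A a b C x :
  flat_local (A ++ [:: a, b, ~~ a & C]) (A ++ b :: C)
    [:: ((size A).+1, Cross x); (size A, Cap)]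
    [:: (size A, Cross x); ((size A).+1, Cap)].
Proof.
by case: x; [apply: (floc_move (iso_cap (size A) (Real true)))
  | apply: (floc_move (iso_cap (size A) Virtual))]; rewrite /= ?stepE; case: a.
Qed.

Lemma floc_kink_cup A b C x :
  flat_local (A ++ C) (A ++ [:: ~~ b, b & C])
    [:: (size A, Cup b); (size A, Cross x)] [:: (size A, Cup (~~ b))].
Proof.
by case: x; [apply: (floc_move (omega1_cup (size A) b true))
  | apply: (floc_move (omega1'_cup (size A) b))]; rewrite /= ?stepE /= ?negbK.
Qed.

Lemma floc_kink_cap A b C x :
  flat_local (A ++ [:: b, ~~ b & C]) (A ++ C)
    [:: (size A, Cross x); (size A, Cap)] [:: (size A, Cap)].
Proof.
by case: x; [apply: (floc_move (omega1_cap (size A) true))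
  | apply: (floc_move (omega1'_cap (size A)))]; rewrite /= ?stepE; case: b.
Qed.

Lemma floc_double A a b C x :
  flat_local (A ++ [:: a, b & C]) (A ++ [:: a, b & C])
    [:: (size A, Cross x); (size A, Cross x)] [::].
Proof.
by case: x; [apply: (floc_move (omega2 (size A) true))
  | apply: (floc_move (omega2' (size A)))]; rewrite /= ?stepE.
Qed.

Lemma floc_double1 A d a b C x :
  flat_local (A ++ [:: d, a, b & C]) (A ++ [:: d, a, b & C])
    [:: ((size A).+1, Cross x); ((size A).+1, Cross x)] [::].
Proof.
by rewrite -cat_rcons -(size_rcons A d); apply: floc_double.
Qed.

Lemma floc_exchange A P P' B Q Q' C (e f : elem fcrossing) i j k :
  size P = strands_in e -> step P (0, e) = Some P' ->
  size Q = strands_in f -> step Q (0, f) = Some Q' ->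
  i = size A -> j = size A + strands_out e + size B ->
  k = size A + strands_in e + size B ->
  flat_local (A ++ P ++ B ++ Q ++ C) (A ++ P' ++ B ++ Q' ++ C)
    [:: (i, e); (j, f)] [:: (k, f); (i, e)].
Proof.
move=> sP eP sQ fQ -> -> ->.
have sP' : size P' = strands_out e.
  by have := size_step eP; rewrite /= sP addnC => /addnI.
have := floc_move (s := A ++ P ++ B ++ Q ++ C) (t := A ++ P' ++ B ++ Q' ++ C)
  (iso_exchange (size A) (size B) (lift_elem e) (lift_elem f)).
have -> : strands_out (lift_elem e) = strands_out e by case: (e) => [||[]].
have -> : strands_in (lift_elem e) = strands_in e by case: (e) => [||[]].
rewrite /= !lift_elemK; apply.
  rewrite (step_local _ _ sP eP) /= -sP' -!size_cat 2!catA.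
  by rewrite (step_local _ _ sQ fQ) -!catA.
rewrite -sP -!size_cat 2!catA.
by rewrite (step_local _ _ sQ fQ) /= -!catA (step_local _ _ sP eP).
Qed.

End FlatLocal.

(** * Numbers of components *)

Section Labels.
Implicit Types (st A B : seq (bool * nat)) (sg : nat -> nat) (e : bool * nat).

(* A strand is named by its direction (true is upwards) and a number; sg maps *)
(* the number of an upward strand to that of the downward strand joined to it *)
(* below.  Hence key takes the same value exactly on joined strands, and the  *)
(* labels of trace_step are the keys up to an injective renaming f.  All      *)
(* numbers are below N. *)
Definition ups st := [seq e.2 | e <- st & e.1].
Definition downs st := [seq e.2 | e <- st & ~~ e.1].
Definition key sg e := if e.1 then sg e.2 else e.2.

Definition matching st sg :=
  [/\ uniq (ups st), uniq (downs st) & perm_eq (map sg (ups st)) (downs st)].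

Definition traced st N sg (ls : seq nat) n : Prop :=
  [/\ matching st sg, all (fun e => e.2 < N) st &
    exists f, [/\ ls = [seq f (key sg e) | e <- st],
      {in map (key sg) st &, injective f} & all (fun l => l < n) ls]].

Lemma matching_perm st st' sg :
  perm_eq st st' -> matching st sg -> matching st' sg.
Proof.
move=> p [uu ud pud].
have pu : perm_eq (ups st) (ups st') by apply/perm_map/perm_filter.
have pd : perm_eq (downs st) (downs st') by apply/perm_map/perm_filter.
split; rewrite -?(perm_uniq pu) -?(perm_uniq pd) //.
rewrite -(permPr pd); apply: perm_trans pud.
by rewrite perm_sym perm_map.
Qed.

Lemma perm_swap2 (T : eqType) (s t : seq T) x y :
  perm_eq (s ++ [:: x, y & t]) (s ++ [:: y, x & t]).
Proof. by rewrite perm_cat2l (perm_catCA [:: x] [:: y] t). Qed.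

Lemma perm_front (T : eqType) (s t : seq T) x y :
  perm_eq (s ++ [:: x, y & t]) [:: x, y & s ++ t].
Proof. by rewrite (perm_catCA s [:: x; y] t). Qed.

Lemma key_downs st sg e : matching st sg -> e \in st -> key sg e \in downs st.
Proof.
case=> _ _ p; case: e => [[] x] ex; rewrite /key /=.
  by rewrite -(perm_mem p) map_f //; apply/mapP; exists (true, x);
    rewrite ?mem_filter.
by apply/mapP; exists (false, x); rewrite ?mem_filter.
Qed.

(* After a maximum joins u to d, the strand that was joined to d below is     *)
(* joined to the partner of u.  If sg u = d the maximum closes a component    *)
(* and sg is unchanged away from u. *)
Definition cap_match sg u d := fun x => if sg x == d then sg u else sg x.

(** If the maximum does not close a component, [d] is the partner of some other upward strand.
    Redirecting that strand to [sg u] replaces [d] by [sg u] among the partners of the remaining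
    strands, which are then exactly the remaining downward ones. *)
Lemma matching_cap st sg u d :
  matching [:: (true, u), (false, d) & st] sg ->
  matching st (cap_match sg u d).
Proof.
rewrite /matching /ups /downs /= => -[/andP[uU uu] /andP[dD ud] p].
split=> //; move: p.
set U := [seq e.2 | e <- st & e.1] in uU uu *.
set D := [seq e.2 | e <- st & ~~ e.1] in dD ud *.
move=> p; have [eud|nud] := eqVneq (sg u) d.
  move: p; rewrite eud perm_cons; apply: perm_trans.
  rewrite (_ : map _ U = map sg U) //; apply: eq_map => x.
  by rewrite /cap_match eud; case: eqP.
have dU : d \in map sg U.
  by have := mem_head d D; rewrite -(perm_mem p) inE eq_sym (negPf nud).
have pr := perm_to_rem dU; set R := rem d _ in pr.
have pD : perm_eq D (sg u :: R).
  rewrite -(perm_cons d) -(permPl p) perm_sym.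
  by rewrite (permPl (perm_swap2 [::] _ _ _)) /= perm_cons perm_sym.
have dR : d \notin R.
  by apply: contra dD => dR; rewrite (perm_mem pD) inE dR orbT.
rewrite (permPr pD).
have -> : map (cap_match sg u d) U =
    [seq if x == d then sg u else x | x <- map sg U].
  by rewrite -(map_comp _ sg U).
rewrite (permPl (perm_map _ pr)) /= eqxx perm_cons.
rewrite (_ : map _ R = R) // map_id_in // => x xR.
by case: eqP xR dR => // -> ->.
Qed.

Lemma traced_cup A B N M sg ls n b u d : traced (A ++ B) N sg ls n ->
  u \notin ups (A ++ B) -> d \notin downs (A ++ B) ->
  N <= M -> u < M -> d < M ->
  traced (A ++ [:: (b, if b then u else d), (~~ b, if b then d else u) & B]) M
    (fun x => if x == u then d else sg x)
    (take (size A) ls ++ [:: n, n & drop (size A) ls]) n.+1.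
Proof.
set sg' := fun x => _; set e1 := (b, _); set e2 := (~~ b, _).
move=> [mt lt [f [-> fi ln]]] nU nD leNM ltuM ltdM.
have sgE e : e \in A ++ B -> key sg' e = key sg e.
  move=> eAB; rewrite /key /sg'; case: ifP => // e1T.
  case: eqP => // eu; case/negP: nU; rewrite -eu.
  by apply/mapP; exists e; rewrite ?mem_filter ?e1T.
have keyd e : e \in A ++ B -> (key sg e == d) = false.
  by move=> eAB; apply: contraNF nD => /eqP <-; apply: key_downs.
have k1 : key sg' e1 = d by rewrite /key /sg' /=; case: (b); rewrite ?eqxx.
have k2 : key sg' e2 = d by rewrite /key /sg' /=; case: (b); rewrite ?eqxx.
have ltM : all (fun e => e.2 < M) (A ++ [:: e1, e2 & B]).
  rewrite (perm_all _ (perm_front _ _ _ _)) /=.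
  apply/and3P; split; [by case: (b)|by case: (b)|].
  by apply/allP=> e /(allP lt) /= /leq_trans; apply.
split=> //.
  apply: (matching_perm (st := [:: (true, u), (false, d) & A ++ B])).
    rewrite perm_sym (permPl (perm_front _ _ _ _)) /e1 /e2.
    by case: (b) => //=; rewrite (perm_swap2 [::]).
  case: mt => uu ud p.
  split; rewrite /ups /downs /= ?nU ?nD //.
  rewrite {1}/sg' eqxx perm_cons -/(ups _) -/(downs _).
  rewrite (_ : map _ _ = map sg (ups (A ++ B))) //.
  apply/eq_in_map => x xU; rewrite /sg'; case: eqP => // xu.
  by rewrite -xu xU in nU.
exists (fun x => if x == d then n else f x); split.
- rewrite !map_cat /= take_size_cat ?size_map // drop_size_cat ?size_map //.
  rewrite k1 k2 eqxx.
  by congr (_ ++ [:: _, _ & _]); apply/eq_in_map => x xAB;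
    rewrite sgE ?keyd // mem_cat xAB ?orbT.
- have keyS x : x \in A ++ [:: e1, e2 & B] -> key sg' x = d \/ x \in A ++ B.
    rewrite (perm_mem (perm_front _ _ _ _)) !inE.
    by case/or3P=> [/eqP->|/eqP->|]; [left|left|right].
  have fn e : e \in A ++ B -> (f (key sg e) == n) = false.
    move=> eAB; apply: ltn_eqF.
    by apply: (allP ln); apply: (map_f (fun e => f (key sg e))).
  move=> _ _ /mapP[x1 /keyS h1 ->] /mapP[x2 /keyS h2 ->].
  case: h1 h2 => [->|h1] [->|h2] //; rewrite ?eqxx.
  + by rewrite sgE // keyd // => /esym/eqP; rewrite fn.
  + by rewrite sgE // keyd // => /eqP; rewrite fn.
  + by rewrite !sgE // !keyd //; apply: fi; apply: map_f.
- rewrite (perm_all _ (perm_front _ _ _ _)) /= ltnSn /= cat_take_drop.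
  by apply/allP=> x /(allP ln) /ltnW.
Qed.

Lemma traced_cross A B e1 e2 N sg ls n :
  traced (A ++ [:: e1, e2 & B]) N sg ls n ->
  traced (A ++ [:: e2, e1 & B]) N sg
    (take (size A) ls ++
      [:: nth 0 ls (size A).+1, nth 0 ls (size A) & drop (size A).+2 ls]) n.
Proof.
have pm := perm_swap2 A B e1 e2.
move=> [mt lt [f [lsE fi ln]]]; split.
- exact: matching_perm pm mt.
- by rewrite -(perm_all _ pm).
exists f.
have E : take (size A) ls ++
      [:: nth 0 ls (size A).+1, nth 0 ls (size A) & drop (size A).+2 ls] =
    [seq f (key sg e) | e <- A ++ [:: e2, e1 & B]].
  rewrite lsE !map_cat /= take_size_cat ?size_map // !nth_cat !size_map.
  rewrite ltnn subnn /= ltnNge leqnSn /= subSnn /=.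
  rewrite -[(size A).+2]addn2 -(size_map (fun e => f (key sg e)) A) addnC.
  rewrite -drop_drop.
  by rewrite drop_size_cat //= drop0.
split=> //.
  move=> x y; rewrite -!(perm_mem (perm_map _ pm)); exact: fi.
by rewrite E -(perm_all _ (perm_map _ pm)) -lsE.
Qed.

Lemma traced_cap A B N sg ls n a u d :
  let st := A ++ [:: (a, if a then u else d), (~~ a, if a then d else u) & B] in
  let x := nth 0 ls (size A) in
  let y := nth 0 ls (size A).+1 in
  let ls' := take (size A) ls ++ drop (size A).+2 ls in
  traced st N sg ls n ->
  (x == y) = (sg u == d) /\
  traced (A ++ B) N (cap_match sg u d)
    (if x == y then ls' else [seq if c == x then y else c | c <- ls']) n.
Proof.
set e1 := (a, _); set e2 := (~~ a, _) => /= -[mt lt [f [lsE fi ln]]].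
have pm := perm_front A B e1 e2.
have pud : perm_eq [:: e1, e2 & A ++ B] [:: (true, u), (false, d) & A ++ B].
  by rewrite /e1 /e2; case: (a) => //=; rewrite (perm_swap2 [::]).
have pm' := perm_trans pm pud.
have mt' := matching_perm pm' mt.
set F := fun e => f (key sg e) in lsE.
have lsE' : ls = map F A ++ [:: F e1, F e2 & map F B] by rewrite lsE map_cat.
have -> : nth 0 ls (size A) = F e1.
  by rewrite lsE' nth_cat size_map ltnn subnn.
have -> : nth 0 ls (size A).+1 = F e2.
  by rewrite lsE' nth_cat size_map ltnNge leqnSn subSnn.
have -> : take (size A) ls ++ drop (size A).+2 ls = map F (A ++ B).
  rewrite lsE' -[(size A).+2]addn2 -(size_map F A) addnC -drop_drop.
  by rewrite take_size_cat // drop_size_cat //= drop0 map_cat.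
have inK e : e \in A ++ B -> key sg e \in map (key sg) (A ++ [:: e1, e2 & B]).
  by move=> eAB; rewrite map_f // (perm_mem pm) !inE eAB !orbT.
have in1 : key sg e1 \in map (key sg) (A ++ [:: e1, e2 & B]).
  by rewrite map_f // (perm_mem pm) mem_head.
have in2 : key sg e2 \in map (key sg) (A ++ [:: e1, e2 & B]).
  by rewrite map_f // (perm_mem pm) !inE eqxx orbT.
have finE z t : z \in map (key sg) (A ++ [:: e1, e2 & B]) ->
    t \in map (key sg) (A ++ [:: e1, e2 & B]) -> (f z == f t) = (z == t).
  by move=> zi ti; apply/eqP/eqP => [|->] //; apply: fi.
have k12 : (key sg e1 == key sg e2) = (sg u == d).
  by rewrite /e1 /e2 /key /=; case: (a) => //=; rewrite eq_sym.
have FE : (F e1 == F e2) = (sg u == d) by rewrite finE.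
split=> //.
have mtAB := matching_cap mt'.
have ltAB : all (fun e => e.2 < N) (A ++ B).
  by move: lt; rewrite (perm_all _ pm) /= => /and3P[].
(* On keys, the maximum amounts to renaming [d] to [sg u]. *)
pose ren z := if z == d then sg u else z.
have renE e : e \in A ++ B -> key (cap_match sg u d) e = ren (key sg e).
  rewrite /key /cap_match /ren; case: ifP => // eF eAB.
  case: eqP => // ed; case: mt' => _ + _.
  rewrite /downs /= => /andP[/negP[]]; rewrite -ed.
  by apply/mapP; exists e; rewrite ?mem_filter ?eF.
have lnF z : z \in map (key sg) (A ++ [:: e1, e2 & B]) -> f z < n.
  case/mapP=> e es ->; apply: (allP ln); rewrite lsE; exact: (map_f F).
split=> //; rewrite FE; case: eqP => [ud|/eqP nud].
  have renK z : ren z = z by rewrite /ren ud; case: eqP.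
  exists f; split.
  - by apply/eq_in_map => e eAB; rewrite renE // renK.
  - move=> _ _ /mapP[z1 i1 ->] /mapP[z2 i2 ->]; rewrite !renE // !renK.
    by apply: fi; apply: inK.
  - by apply/allP=> _ /mapP[e eAB ->]; apply/lnF/inK.
have ke1 : key sg e1 = if a then sg u else d.
  by rewrite /key /e1 /=; case: (a).
have ke2 : key sg e2 = if a then d else sg u.
  by rewrite /key /e2 /=; case: (a).
have uin : sg u \in map (key sg) (A ++ [:: e1, e2 & B]).
  by move: in1 in2; rewrite ke1 ke2; case: (a).
have din : d \in map (key sg) (A ++ [:: e1, e2 & B]).
  by move: in1 in2; rewrite ke1 ke2; case: (a).
have ren_keys e : e \in A ++ B ->
    ren (key sg e) \in map (key sg) (A ++ [:: e1, e2 & B]) /\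
    ren (key sg e) != d.
  move=> eAB; rewrite /ren; case: eqP => [_|/eqP ned]; last by rewrite inK.
  by [].
(* [trace_step] always replaces the label of the left leg by that of the right leg. If the left leg
   is upward, the class of [sg u] therefore takes the label of [d]; otherwise it keeps its own. *)
exists (if a then fun z => if z == sg u then f d else f z else f); split.
- rewrite -map_comp; apply/eq_in_map => e eAB /=; rewrite renE //.
  rewrite /F !finE ?(inK _ eAB) // ke1 ke2 /ren; case: (a).
  + case: (eqVneq (key sg e) d) => [->|ned]; last by case: ifP.
    by rewrite eqxx eq_sym (negPf nud).
  + by case: eqP.
- move=> _ _ /mapP[z1 i1 ->] /mapP[z2 i2 ->]; rewrite !renE //.
  have [r1 n1] := ren_keys _ i1; have [r2 n2] := ren_keys _ i2.
  case: (a); last exact: fi.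
  case: eqP => [->|_]; case: eqP => [-> //|_]; last exact: fi.
  + by move/(fi _ _ din r2) => ed; rewrite -ed eqxx in n2.
  + by move/(fi _ _ r1 din) => ed; rewrite ed eqxx in n1.
- apply/allP=> _ /mapP[_ /mapP[e eAB ->] ->].
  by case: ifP => _; apply: lnF => //; apply: inK.
Qed.

(* Either the two bijections agree and the numbers of closed components k1    *)
(* and k2 differ by one, or k1 = k2 and they differ by a transposition.       *)
Definition paired st sg1 sg2 (k1 k2 : nat) : Prop :=
  {in ups st, sg1 =1 sg2} /\ (k2 = k1.+1 \/ k1 = k2.+1) \/
  k1 = k2 /\ exists x y, [/\ [&& x \in ups st, y \in ups st & x != y],
    sg1 x = sg2 y, sg1 y = sg2 x &
    {in ups st, forall z, z != x -> z != y -> sg1 z = sg2 z}].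

Lemma paired_perm st st' sg1 sg2 k1 k2 : perm_eq st st' ->
  paired st sg1 sg2 k1 k2 -> paired st' sg1 sg2 k1 k2.
Proof.
move=> p; have /perm_mem pu : perm_eq (ups st) (ups st').
  exact/perm_map/perm_filter.
case=> [[eqsg k12]|[-> [x [y [xy sxy syx eqsg]]]]].
  by left; split=> // z; rewrite -pu => /eqsg.
right; split=> //; exists x, y; split; rewrite -?pu // => z.
by rewrite -pu; apply: eqsg.
Qed.

Lemma matching_inj st sg : matching st sg -> {in ups st &, injective sg}.
Proof.
case=> _ ud p; have {ud p}: uniq (map sg (ups st)) by rewrite (perm_uniq p).
elim: (ups st) => //= x U IHU /andP[nx /IHU inj] y z; rewrite !inE.
case/predU1P=> [->|yU] /predU1P[->|zU] // e; last exact: inj.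
  by case/negP: nx; rewrite e map_f.
by case/negP: nx; rewrite -e map_f.
Qed.

(** Only a transposition that involves [u] needs care. If one of the bijections joins [u] to [d],
    its diagram closes a component, and the rerouting in the other removes the discrepancy. If
    neither does, the strand joined to [d], the same one for both, takes the place of [u] in the
    transposition. *)
Lemma paired_cap st u d sg1 sg2 k1 k2 :
  let st' := [:: (true, u), (false, d) & st] in
  matching st' sg1 -> matching st' sg2 -> paired st' sg1 sg2 k1 k2 ->
  paired st (cap_match sg1 u d) (cap_match sg2 u d)
    (k1 + (sg1 u == d)) (k2 + (sg2 u == d)).
Proof.
move=> st' m1 m2.
have uU : u \in ups st' by rewrite mem_head.
have upsE : ups st' = u :: ups st by [].
have sU x : x \in ups st -> x \in ups st' by rewrite upsE inE orbC => ->.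
have [nu _ _] := m1; move: nu; rewrite upsE /= => /andP[nu _].
have neU x : x \in ups st -> x != u by apply: contraTneq => ->.
case=> [[eqsg k12]|[-> [x [y []]]]].
  left; split; first by move=> z zU; rewrite /cap_match !eqsg // sU.
  by rewrite eqsg //; case: k12 => ->; [left|right].
(* The transposed strands play symmetric roles and are distinct, so at most one of them is [u]. *)
wlog: x y / y != u.
  move=> IH xy sxy syx eqsg; have [yu|] := eqVneq y u;
    last by move=> yu; apply: (IH x y).
  have /and3P[_ _ nxy] := xy.
  apply: (IH y x) => //; first by rewrite -yu.
    by case/and3P: xy => -> ->; rewrite eq_sym.
  by move=> z zU zy zx; apply: eqsg.
move=> yu /and3P[xU' yU' nxy] sxy syx eqsg.
have yU : y \in ups st by move: yU'; rewrite upsE inE (negPf yu).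
have n1 z t : z \in ups st -> t \in ups st' -> z != t ->
    (sg1 z == sg1 t) = false.
  by move=> zU tU /negPf <-; apply: (inj_in_eq (matching_inj m1)); [apply: sU|].
have n2 z t : z \in ups st -> t \in ups st' -> z != t ->
    (sg2 z == sg2 t) = false.
  by move=> zU tU /negPf <-; apply: (inj_in_eq (matching_inj m2)); [apply: sU|].
have [xu|xu] := eqVneq x u; last first.
  have xU : x \in ups st by move: xU'; rewrite upsE inE (negPf xu).
  have uE : sg1 u = sg2 u by apply: eqsg; rewrite // eq_sym.
  right; rewrite uE; split=> //; exists x, y; split.
  - by rewrite xU yU.
  - by rewrite /cap_match sxy uE.
  - by rewrite /cap_match syx uE.
  - by move=> z zU zx zy; rewrite /cap_match uE eqsg // sU.
subst x; rewrite eq_sym in nxy.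
have [s1d|s1d] := eqVneq (sg1 u) d.
  left; rewrite /= -syx; split; last first.
    rewrite -s1d n1 //.
    by rewrite addn0 addn1; right.
  move=> z zU; rewrite /cap_match.
  rewrite -{1}s1d n1 ?neU //.
  case: (eqVneq z y) => [->|zy]; first by rewrite -sxy s1d eqxx.
  rewrite -eqsg ?sU ?neU //.
  by rewrite -s1d n1 ?neU.
have [s2d|s2d] := eqVneq (sg2 u) d.
  left; rewrite /=; split; last by rewrite addn0 addn1; left.
  move=> z zU; rewrite /cap_match.
  rewrite -{2}s2d n2 ?neU //.
  case: (eqVneq z y) => [->|zy]; first by rewrite syx s2d eqxx.
  rewrite eqsg ?sU ?neU //.
  by rewrite -s2d n2 ?neU.
(* The strand [w] joined to [d] exists by surjectivity of [sg1]; it differs from [u] and [y], so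
   both bijections agree on it. *)
have [_ _ p1] := m1.
have /mapP[w wU' dw] : d \in map sg1 (ups st').
  by rewrite (perm_mem p1) mem_head.
have wu : w != u by apply: contraNneq s1d => <-; rewrite -dw.
have wU : w \in ups st by move: wU'; rewrite upsE inE (negPf wu).
have wy : w != y by apply: contraNneq s2d => wy; rewrite -syx -wy -dw.
have w2 : sg2 w = d by rewrite -eqsg.
right; split=> //; exists w, y; split.
- by rewrite wU yU.
- rewrite /cap_match -dw eqxx -sxy.
  by have /negPf -> : sg1 u != d.
- rewrite /cap_match w2 eqxx -syx.
  by have /negPf -> : sg1 y != d by rewrite syx.
- move=> z zU zw zy; rewrite /cap_match -syx sxy eqsg ?sU ?neU //.
  by rewrite -w2 n2 ?neU.
Qed.

Lemma paired_cup st u d sg1 sg2 k1 k2 : u \notin ups st ->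
  let up sg := fun x : nat => if x == u then d else sg x in
  paired st sg1 sg2 k1 k2 ->
  paired [:: (true, u), (false, d) & st] (up sg1) (up sg2) k1 k2.
Proof.
move=> nu up.
have old x : x \in ups st -> (x == u) = false.
  by move=> xU; apply: contraNF nu => /eqP <-.
case=> [[eqsg k12]|[-> [x [y [/and3P[xU yU xy] sxy syx eqsg]]]]].
  left; split=> // z; rewrite /ups /= inE /up.
  by case/predU1P=> [->|zU]; rewrite ?eqxx // old // eqsg.
right; split=> //; exists x, y; rewrite /up !old // /ups /= !inE; split=> //.
  by rewrite -/(ups st) xU yU !orbT.
move=> z; rewrite inE => /predU1P[->|zU zx zy]; first by rewrite eqxx.
by rewrite old // eqsg.
Qed.

(* The effect of a letter on named strands; up transforms the bijection sg    *)
(* and cl counts the components that it closes.                               *)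
Inductive sweep X : nat * elem X -> seq (bool * nat) -> nat ->
    seq (bool * nat) -> nat -> ((nat -> nat) -> nat -> nat) ->
    ((nat -> nat) -> nat) -> Prop :=
  | sweep_cup A B N b :
      sweep (size A, Cup b) (A ++ B) N
        (A ++ [:: (b, if b then N else N), (~~ b, if b then N else N) & B]) N.+1
        (fun sg x => if x == N then N else sg x) (fun=> 0)
  | sweep_cap A B N a u d :
      sweep (size A, Cap)
        (A ++ [:: (a, if a then u else d), (~~ a, if a then d else u) & B]) N
        (A ++ B) N (fun sg => cap_match sg u d) (fun sg => sg u == d)
  | sweep_cross A B N x e1 e2 :
      sweep (size A, Cross x) (A ++ [:: e1, e2 & B]) N
        (A ++ [:: e2, e1 & B]) N id (fun=> 0).

Lemma sweepP X (g : nat * elem X) st N s : step (map fst st) g = Some s ->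
  exists st' N' up cl, sweep g st N st' N' up cl /\ map fst st' = s.
Proof.
case: g => i e h; have := step_bound h; rewrite size_map /=.
case/cat_split=> A [P [B [stE Ai sP]]]; move: h; rewrite {}stE -{}Ai.
rewrite !map_cat -(size_map fst A).
case: e sP => [b||x]; case: P => [|e1 [|e2 [|//]]] //= _.
- rewrite step_cup size_map => -[<-].
  by do 4!eexists; split; [apply: sweep_cup | rewrite map_cat].
- rewrite step_cap size_map; case: ifP => // e12 [<-].
  case: e1 e2 e12 => [a p] [b q] /= ab; have {ab} -> : b = ~~ a.
    by case: (a) (b) ab => -[].
  have := sweep_cap X A B N a (if a then p else q) (if a then q else p).
  by case: a => sw; do 4!eexists; split; [apply: sw | rewrite map_cat
    | apply: sw | rewrite map_cat].
- rewrite step_cross size_map => -[<-].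
  by do 4!eexists; split; [apply: sweep_cross | rewrite map_cat].
Qed.

Lemma ups_lt st N : all (fun e => e.2 < N) st -> N \notin ups st.
Proof.
move=> lt; apply/negP=> /mapP[e]; rewrite mem_filter => /andP[_ /(allP lt)].
by move=> /[swap] <-; rewrite ltnn.
Qed.

Lemma downs_lt st N : all (fun e => e.2 < N) st -> N \notin downs st.
Proof.
move=> lt; apply/negP=> /mapP[e]; rewrite mem_filter => /andP[_ /(allP lt)].
by move=> /[swap] <-; rewrite ltnn.
Qed.

Lemma traced_sweep X (g : nat * elem X) st N st' N' up cl sg ls n k :
  sweep g st N st' N' up cl -> traced st N sg ls n ->
  let t := trace_step (ls, n, k) g in
  traced st' N' (up sg) t.1.1 t.1.2 /\ t.2 = k + cl sg.
Proof.
move=> sw; move: sw sg ls n k => [].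
- move=> A B {}N b sg ls n k tr /=; rewrite addn0; split=> //.
  have [_ lt _] := tr.
  by apply: traced_cup tr _ _ _ _ _; rewrite ?ups_lt ?downs_lt ?leqnSn.
- move=> A B {}N a u d sg ls n k /traced_cap /= [eqE tr].
  rewrite -eqE; move: tr; case: ifP => _ tr; rewrite ?addn0 ?addn1; split=> //.
- by move=> A B {}N x e1 e2 sg ls n k /traced_cross; rewrite addn0.
Qed.

Global Arguments trace_step : simpl never.

Lemma paired_sweep X (g : nat * elem X) st N st' N' up cl sg1 sg2 k1 k2 :
  sweep g st N st' N' up cl -> all (fun e => e.2 < N) st ->
  matching st sg1 -> matching st sg2 -> paired st sg1 sg2 k1 k2 ->
  paired st' (up sg1) (up sg2) (k1 + cl sg1) (k2 + cl sg2).
Proof.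
case=> {st st' up cl}.
- move=> A B {}N b lt _ _ /(paired_cup N (ups_lt lt)); rewrite !addn0.
  apply: paired_perm; rewrite perm_sym (permPl (perm_front _ _ _ _)) !if_same.
  by case: (b) => //=; rewrite (perm_swap2 [::]).
- move=> A B {}N a u d _; set st := A ++ _.
  have p : perm_eq st [:: (true, u), (false, d) & A ++ B].
    rewrite (permPl (perm_front _ _ _ _)).
    by case: (a) => //=; rewrite (perm_swap2 [::]).
  move=> /(matching_perm p) m1 /(matching_perm p) m2 /(paired_perm p).
  exact: paired_cap.
- by move=> A B {}N x e1 e2 _ _ _; rewrite !addn0; apply/paired_perm/perm_swap2.
Qed.

(** * Simultaneous sweeps of two diagrams *)

Definition trace X (w : word X) t := foldl (@trace_step X) t w.

Lemma traced_run X (w : word X) st N sg ls n k s :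
  traced st N sg ls n -> run (map fst st) w = Some s ->
  exists st' N' sg', map fst st' = s /\
    traced st' N' sg' (trace w (ls, n, k)).1.1 (trace w (ls, n, k)).1.2.
Proof.
elim: w st N sg ls n k => [|g w IHw] st N sg ls n k tr.
  by case=> <-; exists st, N, sg.
rewrite /trace /= -/(trace w _).
case h: (step _ g) => [s1|//].
have [st1 [N1 [up [cl [sw <-]]]]] := sweepP N h.
have [] := traced_sweep k sw tr.
by case: (trace_step _ g) => -[ls1 n1] k1 /= tr1 _; apply: IHw tr1.
Qed.

(** The last clause says that the second diagram has an open strand or a closed component. It
    survives to the top, where it excludes a smoothed diagram with no component. *)
Definition paired_trace s (t1 t2 : seq nat * nat * nat) : Prop :=
  exists st N sg1 sg2, [/\ map fst st = s,
    traced st N sg1 t1.1.1 t1.1.2, traced st N sg2 t2.1.1 t2.1.2,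
    paired st sg1 sg2 t1.2 t2.2 & (st != [::]) || (0 < t2.2)].

Lemma paired_step X (g : nat * elem X) s s' t1 t2 :
  step s g = Some s' -> paired_trace s t1 t2 ->
  paired_trace s' (trace_step t1 g) (trace_step t2 g).
Proof.
case: t1 t2 => [[ls1 n1] k1] [[ls2 n2] k2] h [st [N [sg1 [sg2 []]]]] /= stE.
move: h; rewrite -stE => /(sweepP N)[st' [N' [up [cl [sw <-]]]]] tr1 tr2 p nz.
have [mt1 lt _] := tr1; have [mt2 _ _] := tr2.
have := paired_sweep sw lt mt1 mt2 p.
have [] := traced_sweep k1 sw tr1; have [] := traced_sweep k2 sw tr2.
move=> /= r2 c2 r1 c1 p'; exists st', N', (up sg1), (up sg2).
rewrite c1 c2; split=> //.
case: sw mt2 {p p' r1 r2 c1 c2 tr1 tr2 stE mt1 lt} nz => {st st' up cl}.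
- by move=> A B N1 b _ _; case: A.
(* When the maximum consumes the last two strands, they are joined to each other, so it closes a
   component. *)
- move=> A B _ a u d + _; case: A => //; case: B => //= -[_ _].
  case: a => /=; rewrite /ups /downs /= => /perm_mem/(_ d).
    by rewrite !inE eqxx eq_sym => ->; rewrite addn1.
  by rewrite !inE eqxx eq_sym => ->; rewrite addn1.
- by move=> A B N1 x e1 e2 _ _; case: A.
Qed.

Lemma paired_run X (w : word X) s t1 t2 :
  run s w = Some [::] -> paired_trace s t1 t2 ->
  ((trace w t2).2 = (trace w t1).2.+1 \/ (trace w t1).2 = (trace w t2).2.+1) /\
  0 < (trace w t2).2.
Proof.
elim: w s t1 t2 => [|g w IHw] s t1 t2.
  case=> -> [st [N [sg1 [sg2 []]]]]; case: st => // _ _ _ p nz; split=> //.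
  (* With no strand left there is nothing to transpose, so the counts differ by one. *)
  by case: p => [[]|[_ [x [y []]]]].
rewrite /trace /= -!/(trace w _).
by case h: (step s g) => [s1|//] /IHw IH /(paired_step h); apply: IH.
Qed.

Lemma traced_init : traced [::] 0 id [::] 0.
Proof. by split=> //; exists id. Qed.

(** The empty smoothing leaves the labels in place while the crossing exchanges the names. Upward
    names are swapped by precomposing [sg] with the transposition, downward names by postcomposing,
    and the latter is again a transposition of the upward strands joined to [p] and [q]. *)
Lemma traced_parallel A B N sg ls n k a p q :
  traced (A ++ [:: (a, p), (a, q) & B]) N sg ls n ->
  exists2 sg', traced (A ++ [:: (a, q), (a, p) & B]) N sg' ls n &
    paired (A ++ [:: (a, q), (a, p) & B]) sg sg' k k.
Proof.
set st := A ++ _; set st' := A ++ _.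
have pm : perm_eq st st' by apply: perm_swap2.
have pf : perm_eq st [:: (a, p), (a, q) & A ++ B] by apply: perm_front.
have pf' : perm_eq [:: (a, q), (a, p) & A ++ B] st'.
  by rewrite perm_sym; apply: perm_front.
move=> [mt lt [f [lsE fi ln]]]; have lt' := lt; rewrite (perm_all _ pm) in lt'.
have := matching_perm pf mt; rewrite /matching /ups /downs.
case: a @st @st' lsE fi lt lt' mt pm pf pf'
  => st st' lsE fi lt lt' mt pm pf pf' /=.
- rewrite inE negb_or -andbA => -[/and4P[npq pU qU uU] uD p1].
  pose sg' x := if x == p then sg q else if x == q then sg p else sg x.
  have old x : x \in ups (A ++ B) -> sg' x = sg x.
    rewrite /sg'; case: eqP => [->|_]; first by rewrite /ups (negPf pU).
    by case: eqP => [->|//]; rewrite /ups (negPf qU).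
  have sgp : sg' p = sg q by rewrite /sg' eqxx.
  have sgq : sg' q = sg p by rewrite /sg' eqxx eq_sym (negPf npq).
  exists sg'; last first.
    apply: paired_perm pf' _; right; split=> //; exists p, q; split=> //.
      by rewrite /ups /= !inE !eqxx orbT npq.
    move=> x; rewrite /ups /= !inE => /or3P[/eqP->|/eqP->|xU _ _];
      rewrite ?eqxx //.
    by rewrite old.
  split=> //.
    apply: matching_perm pf' _; rewrite /matching /ups /downs /=.
    split=> //; first by rewrite inE negb_or eq_sym npq pU qU.
    rewrite sgp sgq -(permPr p1).
    rewrite (_ : map sg' _ = map sg (ups (A ++ B))) //.
    exact/eq_in_map.
  exists f; suff kE : map (key sg') st' = map (key sg) st.
    split=> //; last by rewrite kE.
    by rewrite [LHS]lsE (map_comp f (key sg)) -kE -map_comp.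
  rewrite !map_cat /= /key /= sgp sgq.
  congr (_ ++ [:: _, _ & _]); apply/eq_in_map => -[[] x] xin //=; apply: old;
    by apply/mapP; exists (true, x); rewrite // mem_filter mem_cat xin ?orbT.
- rewrite inE negb_or -andbA => -[uU /and4P[npq pD qD uD] p1].
  pose sw x := if x == p then q else if x == q then p else x.
  have swp : sw p = q by rewrite /sw eqxx.
  have swq : sw q = p by rewrite /sw eqxx eq_sym (negPf npq).
  have swK : involutive sw.
    move=> x; rewrite {2}/sw; case: (eqVneq x p) => [->|xp].
      by rewrite swq.
    case: (eqVneq x q) => [->|xq]; first by rewrite swp.
    by rewrite /sw (negPf xp) (negPf xq).
  have old x : x \in downs (A ++ B) -> sw x = x.
    rewrite /sw; case: eqP => [->|_]; first by rewrite /downs (negPf pD).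
    by case: eqP => [->|//]; rewrite /downs (negPf qD).
  have kE : map (key (sw \o sg)) st' = map sw (map (key sg) st).
    rewrite -map_comp !map_cat /= /key /= swp swq.
    congr (_ ++ [:: _, _ & _]); apply/eq_in_map => -[[] x] xin //=;
      apply/esym/old;
      by apply/mapP; exists (false, x); rewrite // mem_filter mem_cat xin ?orbT.
  exists (sw \o sg); last first.
    apply: paired_perm pf' _; right; split=> //.
    have /mapP[x xU px] : p \in map sg (ups (A ++ B)).
      by rewrite (perm_mem p1) mem_head.
    have /mapP[y yU qy] : q \in map sg (ups (A ++ B)).
      by rewrite (perm_mem p1) !inE eqxx orbT.
    exists x, y; split.
    - by rewrite /ups /= xU yU /=; apply: contraNneq npq => xy;
         rewrite px qy xy.
    - by rewrite /= -qy swq px.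
    - by rewrite /= -px swp qy.
    move=> z zU zx zy; rewrite /= /sw px qy.
    have inj := matching_inj mt.
    have iU t : t \in ups (A ++ B) -> t \in ups st.
      by rewrite (perm_mem (perm_map _ (perm_filter _ pf))).
    by rewrite !(inj_in_eq inj) ?iU // (negPf zx) (negPf zy).
  split=> //.
    apply: matching_perm pf' _; rewrite /matching /ups /downs /=.
    split=> //; first by rewrite inE negb_or eq_sym npq pD qD.
    rewrite (map_comp sw sg) (permPl (perm_map sw p1)) /= swp swq.
    by rewrite (_ : map sw _ = downs (A ++ B)) // map_id_in.
  exists (f \o sw); split=> //.
    rewrite lsE (map_comp f (key sg)) (map_comp (f \o sw) (key _)) kE.
    rewrite -!map_comp.
    by apply: eq_map => e /=; rewrite swK.
  rewrite kE => _ _ /mapP[x xi ->] /mapP[y yi ->] /=.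
  by rewrite !swK => /(fi _ _ xi yi) ->.
Qed.

(** The maximum joins the former partners of [u] and [d], and the minimum joins [u] to [d]. If [u]
    and [d] were already joined, one component closes and the bijection is unchanged; otherwise it
    changes by transposing [u] with the strand that was joined to [d]. *)
Lemma traced_antiparallel A B N sg ls n k a u d :
  let st := A ++ [:: (a, if a then u else d), (~~ a, if a then d else u) & B] in
  let st' :=
    A ++ [:: (~~ a, if a then d else u), (a, if a then u else d) & B] in
  let t :=
    trace [:: (size A, Cap); (size A, Cup (~~ a) : elem vcrossing)]
      (ls, n, k) in
  traced st N sg ls n ->
  exists2 sg', traced st' N sg' t.1.1 t.1.2 & paired st' sg sg' k t.2.
Proof.
move=> st st' t tr.
have [mt lt _] := tr.
have p : perm_eq st [:: (true, u), (false, d) & A ++ B].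
  rewrite (permPl (perm_front _ _ _ _)).
  by case: (a) => //=; rewrite (perm_swap2 [::]).
have p' : perm_eq [:: (true, u), (false, d) & A ++ B] st'.
  rewrite perm_sym (permPl (perm_front _ _ _ _)).
  by case: (a) => //=; rewrite (perm_swap2 [::]).
have mt' := matching_perm p mt.
have [] := mt'; rewrite {1 2}/ups {1 2}/downs /=.
move=> /andP[nU uU] /andP[nD uD] pr.
have [eqE tr2] := traced_cap tr.
move: lt; rewrite (perm_all _ p) /= => /and3P[ltu ltd lt].
have := @traced_cup A B N N _ _ n (~~ a) u d tr2 nU nD (leqnn N) ltu ltd.
have -> : (~~ a, if ~~ a then u else d) = (~~ a, if a then d else u).
  by case: (a).
have -> : (~~ ~~ a, if ~~ a then d else u) = (a, if a then u else d).
  by case: (a).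
set sg' := fun x => _ => tr3; exists sg'.
  by rewrite /t /trace /= /trace_step /=; case: eqP tr3.
have -> : t.2 = k + (sg u == d).
  by rewrite -eqE /t /trace /= /trace_step /=; case: eqP; rewrite ?addn1 ?addn0.
apply: paired_perm p' _.
have upsE : ups [:: (true, u), (false, d) & A ++ B] = u :: ups (A ++ B) by [].
have [ud|ud] := eqVneq (sg u) d.
  left; rewrite addn1; split; last by left.
  move=> x _; rewrite /sg' /cap_match ud.
  by case: eqP => [->|_] //; case: eqP.
have /mapP[w wU dw] : d \in map sg (ups [:: (true, u), (false, d) & A ++ B]).
  by have [_ _ /perm_mem->] := mt'; rewrite mem_head.
have wu : w != u by apply: contraNneq ud => <-; rewrite -dw.
right; rewrite addn0; split=> //; exists u, w; split.
- by rewrite wU upsE mem_head eq_sym.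
- by rewrite /sg' (negPf wu) /cap_match -dw eqxx.
- by rewrite /sg' eqxx.
- move=> z zU zu zw; rewrite /sg' (negPf zu) /cap_match dw.
  by rewrite (inj_in_eq (matching_inj mt')) // (negPf zw).
Qed.

(* The names are chosen after the crossing and reused, position by position,  *)
(* for its smoothing, so that both sweeps share the same list of strands. *)
Lemma paired_smoothing A B N sg ls n k e1 e2 (x : vcrossing) :
  let i := size A in
  traced (A ++ [:: e1, e2 & B]) N sg ls n ->
  paired_trace (map fst (A ++ [:: e2, e1 & B]))
    (trace_step (ls, n, k) (i, Cross x))
    (trace (smoothing (map fst (A ++ [:: e1, e2 & B])) i) (ls, n, k)).
Proof.
move=> i tr; have tr1 := traced_cross tr.
have nz e f : (A ++ [:: e, f & B] != [::]) by case: (A).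
case: e1 e2 tr tr1 => a p [b q] tr tr1.
rewrite /smoothing !map_cat !nth_cat !size_map /i ltnn subnn.
rewrite ltnNge leqnSn /= subSnn /=; case: eqP => [eab|/eqP nab].
  subst b; have [sg' tr2 pr] := traced_parallel k tr.
  exists (A ++ [:: (a, q), (a, p) & B]), N, sg, sg'.
  by split; rewrite ?nz ?map_cat.
have {nab} be : b = ~~ a by case: (a) (b) nab => -[].
subst b; have [] := @traced_antiparallel A B N sg ls n k a
  (if a then p else q) (if a then q else p); first by case: (a) tr.
move=> sg' tr2 pr; exists (A ++ [:: (~~ a, q), (a, p) & B]), N, sg, sg'.
split; rewrite ?nz ?map_cat //; by case: (a) tr2 pr.
Qed.

End Labels.

Lemma components_smoothing pre post s i x :
  run [::] pre = Some s ->
  run s ((i, Cross x) :: post) = Some [::] ->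
  components (pre ++ (i, Cross x) :: post) = 1 ->
  components (pre ++ smoothing s i ++ post) = 2.
Proof.
move=> rp rq; rewrite /components !foldl_cat.
have [st [N [sg [stE]]]] := traced_run 0 traced_init rp.
rewrite -/(trace pre _) -[foldl _ _ _]/(trace _ _).
case: (trace pre _) => -[ls n] k tr; rewrite -!/(trace _ _) /trace /= in tr *.
move: rq => /=; case h: (step s _) => [s'|//] rq.
have := step_bound h; rewrite -stE size_map /=.
case/cat_split=> A [P [B [stE' Ai]]].
case: P stE' => [|e1 [|e2 [|//]]] // stE' _.
rewrite {}stE' in stE tr *; rewrite stE.
have := paired_smoothing k x tr; rewrite Ai => pt.
have s'E : s' = map fst (A ++ [:: e2, e1 & B]).
  by move: h; rewrite -stE !map_cat -Ai -(size_map fst A) step_cross => -[].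
rewrite -s'E stE in pt; have [] := paired_run rq pt.
(* The count goes from one to two or to zero, and [gt0] excludes zero. *)
rewrite /trace; case=> -> gt0 eq1; first by rewrite eq1.
by move: gt0 eq1; case: (foldl _ _ post).2.
Qed.

(** * Smoothing and moves *)

Section Smoothings.
Variables (A C : seq bool).
Let i := size A.

(** A strand is pulled off an extremum: sliding one crossing around the extremum brings it next to
    the other, and a second move cancels the pair. The next three lemmas are the variants for the
    other side and for maxima. *)
Lemma floc_cup_over d b (x : fcrossing) :
  flat_local (A ++ d :: C) (A ++ [:: d, b, ~~ b & C])
    [:: (i, Cup b); (i.+1, Cross x); (i, Cross x)] [:: (i.+1, Cup b)].
Proof.
apply: (floc_trans (w := [:: (i.+1, Cup b); (i, Cross x); (i, Cross x)])).
  apply: (floc_ctx (a := [::]) (b := [:: (i, Cross x)])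
    (floc_cup_cross A d b C x)) => //.
  by rewrite /= stepE.
apply: (floc_ctx (a := [:: (i.+1, Cup b)]) (b := [::])
  (floc_double A d b (~~ b :: C) x)) => //.
by rewrite /= stepE.
Qed.

Lemma floc_cup_over1 d b (x : fcrossing) :
  flat_local (A ++ d :: C) (A ++ [:: b, ~~ b, d & C])
    [:: (i.+1, Cup b); (i, Cross x); (i.+1, Cross x)] [:: (i, Cup b)].
Proof.
apply: (floc_trans (w := [:: (i, Cup b); (i.+1, Cross x); (i.+1, Cross x)])).
  apply: (floc_ctx (a := [::]) (b := [:: (i.+1, Cross x)])
    (floc_sym (floc_cup_cross A d b C x))) => //.
  by rewrite /= stepE.
apply: (floc_ctx (a := [:: (i, Cup b)]) (b := [::])
  (floc_double1 A b (~~ b) d C x)) => //.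
by rewrite /= stepE.
Qed.

Lemma floc_cap_over a d (x : fcrossing) :
  flat_local (A ++ [:: a, ~~ a, d & C]) (A ++ d :: C)
    [:: (i.+1, Cross x); (i, Cross x); (i.+1, Cap)] [:: (i, Cap)].
Proof.
apply: (floc_trans (w := [:: (i.+1, Cross x); (i.+1, Cross x); (i, Cap)])).
  apply: (floc_ctx (a := [:: (i.+1, Cross x)]) (b := [::])
    (floc_sym (floc_cross_cap A a d C x))) => //.
  by rewrite /= stepE.
apply: (floc_ctx (a := [::]) (b := [:: (i, Cap)])
  (floc_double1 A a (~~ a) d C x)) => //.
by rewrite /= stepE; case: (a).
Qed.

Lemma floc_cap_over1 a d (x : fcrossing) :
  flat_local (A ++ [:: d, a, ~~ a & C]) (A ++ d :: C)
    [:: (i, Cross x); (i.+1, Cross x); (i, Cap)] [:: (i.+1, Cap)].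
Proof.
apply: (floc_trans (w := [:: (i, Cross x); (i, Cross x); (i.+1, Cap)])).
  apply: (floc_ctx (a := [:: (i, Cross x)]) (b := [::])
    (floc_cross_cap A a d C x)) => //.
  by rewrite /= stepE.
apply: (floc_ctx (a := [::]) (b := [:: (i.+1, Cap)])
  (floc_double A d a (~~ a :: C) x)) => //.
by rewrite /= stepE; case: (a).
Qed.

Lemma nth_cat0 (a : bool) D : nth true (A ++ a :: D) i = a.
Proof. by rewrite nth_cat ltnn subnn. Qed.

Lemma nth_cat1 (a b : bool) D : nth true (A ++ [:: a, b & D]) i.+1 = b.
Proof. by rewrite nth_cat ltnNge leqnSn subSnn. Qed.

Lemma nth_cat2 (a b c : bool) D : nth true (A ++ [:: a, b, c & D]) i.+2 = c.
Proof. by rewrite /i -addn2 nth_cat ltnNge leq_addr addKn. Qed.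

End Smoothings.

(** Smoothing inside a tangle with bottom state [s], so that the smoothing of a diagram can be
    confined to the piece containing the crossing. *)
Definition smooth_from s (w : vword) c : vword :=
  take c w ++
  smoothing (odflt [::] (run s (take c w))) (nth (0, Cap) w c).1 ++
  drop c.+1 w.

Lemma smooth_fromE K c : smooth K c = smooth_from [::] K c.
Proof. by []. Qed.

Lemma smooth_from_pre s u v c : c < size u ->
  smooth_from s (u ++ v) c = smooth_from s u c ++ v.
Proof.
move=> lt_cu; rewrite /smooth_from take_cat lt_cu nth_cat lt_cu -!catA.
congr (_ ++ (_ ++ _)); rewrite drop_cat; case: ltnP => // le_uc.
by rewrite (_ : c.+1 = size u) ?subnn ?drop0 ?drop_size //; lia.
Qed.

Lemma smooth_from_post s t u v c : run s u = Some t ->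
  smooth_from s (u ++ v) (size u + c) = u ++ smooth_from t v c.
Proof.
move=> ru; rewrite /smooth_from take_cat nth_cat drop_cat.
rewrite ltnNge leq_addr addKn /= -addnS ltnNge leq_addr addKn /=.
by rewrite (run_cat _ ru) -catA.
Qed.

Lemma run_smoothing (A C : seq bool) a b :
  run (A ++ [:: a, b & C]) (smoothing (A ++ [:: a, b & C]) (size A)) =
    Some (A ++ [:: b, a & C]).
Proof.
rewrite /smoothing nth_cat0 nth_cat1; case: eqP => [->|/eqP ab] //=.
by rewrite !stepE ab /= stepE; case: (a) (b) ab => -[].
Qed.

Lemma real_crossingP w c : real_crossing w c ->
  exists i o, [/\ c < size w, nth (0, Cap) w c = (i, Cross (Real o)) &
    w = take c w ++ (i, Cross (Real o)) :: drop c.+1 w].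
Proof.
rewrite /real_crossing onthE => rc.
have lt_cw : c < size w.
  by rewrite ltnNge; apply: contraL rc => ?; rewrite nth_default ?size_map.
move: rc; rewrite (nth_map (0, Cap)) //.
case wc: (nth _ w c) => [i [||[o|]]] // _; exists i, o; split=> //.
by rewrite -wc -drop_nth // cat_take_drop.
Qed.

Lemma run_smooth_from s t w c :
  real_crossing w c -> run s w = Some t -> run s (smooth_from s w c) = Some t.
Proof.
case/real_crossingP=> i [o [_ wc wE]]; rewrite {1}wE => /run_catP[s1 r1] /=.
case h: (step s1 _) => [s2|//] r2.
rewrite /smooth_from r1 wc (run_cat _ r1) /=.
have := step_bound h; rewrite addn2 /= => /split2[A [a [b [C [s1E iE]]]]].
move: h; rewrite {}s1E -{}iE step_cross => -[s2E].
by rewrite (run_cat _ (run_smoothing _ _ _ _)) s2E.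
Qed.

Lemma cat_prefix (T : Type) (u v x y : seq T) :
  size u <= size v -> v ++ x = u ++ y -> exists2 B, v = u ++ B & y = B ++ x.
Proof.
elim: u v => [|a u IHu] [|b v] //=; first by exists [::].
  by move=> _ <-; exists (b :: v).
by rewrite ltnS => /IHu IH [<-] /IH[B -> ->]; exists B.
Qed.

Lemma exchangeP X (e f : elem X) i j s t :
  run s [:: (i, e); (i + strands_out e + j, f)] = Some t ->
  exists A P P' B Q Q' C, [/\ s = A ++ P ++ B ++ Q ++ C,
    t = A ++ P' ++ B ++ Q' ++ C, i = size A /\ j = size B,
    size P = strands_in e /\ step P (0, e) = Some P' &
    size Q = strands_in f /\ step Q (0, f) = Some Q'].
Proof.
rewrite /=; case he: (step s _) => [s1|//].
case hf: (step s1 _) => [s2|//] [<-].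
have [A [P [P' [D [-> s1E iA sP eP]]]]] := stepP he.
have [A2 [Q [Q' [C [s1E2 -> sA2 sQ fQ]]]]] := stepP hf.
have sP' : size P' = strands_out e.
  by have := size_step eP; rewrite /= sP addnC => /addnI.
have le_A2 : size (A ++ P') <= size A2 by rewrite size_cat sP' sA2 iA leq_addr.
have [|B A2E ->] := cat_prefix le_A2 (x := Q ++ C) (y := D).
  by rewrite -s1E2 s1E catA.
exists A, P, P', B, Q, Q', C; split=> //; first by rewrite A2E -!catA.
by move: sA2; rewrite A2E !size_cat sP' -iA => /addnI.
Qed.

Lemma run_exchange X (e f : elem X) A P P' B Q Q' C :
  size P = strands_in e -> step P (0, e) = Some P' ->
  size Q = strands_in f -> step Q (0, f) = Some Q' ->
  run (A ++ P ++ B ++ Q ++ C)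
    [:: (size A + strands_in e + size B, f); (size A, e)] =
  Some (A ++ P' ++ B ++ Q' ++ C).
Proof.
move=> sP eP sQ fQ; rewrite -sP -2!size_cat 2!catA /=.
by rewrite (step_local _ _ sQ fQ) /= -!catA (step_local _ _ sP eP).
Qed.

Lemma run_bound X (g : nat * elem X) w s t :
  run s (g :: w) = Some t -> g.1 + strands_in g.2 <= size s.
Proof. by rewrite /=; case h: (step s g) => // _; apply: step_bound h. Qed.

Lemma run_third i x y z s t t' : run s (third_lhs i x y z) = Some t ->
  run s (third_rhs i x y z) = Some t' -> t = t'.
Proof.
move=> h h'; have := run_bound h'; rewrite /= addn2.
case/split3=> A [a [b [c [C [sE iE]]]]]; move: h h'; rewrite {}sE -{}iE /=.
by rewrite !stepE => -[<-] [<-].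
Qed.

(** Validity only says that the two whole diagrams are closed; this shows that the upper context
    starts from the same state on both sides. *)
Lemma local_move_run k l r m s t t' : local_move k l r m ->
  run s l = Some t -> run s r = Some t' -> t = t'.
Proof.
case=> {k l r m}.
- move=> i j e f /exchangeP[A [P [P' [B [Q [Q' [C]]]]]]].
  case=> -> -> [-> ->] [sP eP] [sQ fQ].
  by rewrite (run_exchange _ _ _ sP eP sQ fQ) => -[].
- move=> i b h; have := run_bound h.
  rewrite /= addn0 => /split1[A [d [C [sE iE]]]].
  move: h; rewrite {}sE -{}iE /= stepE /= stepE.
  by case: d b => -[] //= [<-] [].
- move=> i b; rewrite /=; case h1: (step s _) => [s1|//].
  case h2: (step s1 _) => [s2|//] [<-] [<-].
  (* The minimum alone could stand to the right of all strands; it is the maximum that needs a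
     strand at position [i]. *)
  have lt_is : i < size s by move: (step_bound h2) (size_step h1) => /=; lia.
  have [A [d [C [sE iE]]]] := split1 lt_is.
  move: h1; rewrite sE -iE step_cup => -[s1E].
  by move: h2; rewrite -s1E -iE step_cap1; case: b d {s1E sE} => -[] // [<-].
- move=> i b x h h'; have := run_bound h'; rewrite /= addn0.
  case/split1=> A [d [C [sE iE]]]; move: h h'; rewrite {}sE -{}iE /=.
  by rewrite !stepE /= ?stepE /= => -[<-] [<-].
- move=> i x h; have := run_bound h; rewrite /= addn2.
  case/split3=> A [a [b [c [C [sE iE]]]]] h'; move: h h'; rewrite {}sE -{}iE /=.
  by rewrite !stepE /= ?stepE /=; case: ifP => // _ [<-] [<-].
- move=> i b o h; have := run_bound h; rewrite /= addn0.
  case/split0=> A [C [sE iE]] h'; move: h h'; rewrite {}sE -{}iE /=.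
  by rewrite !stepE /= ?stepE /= negbK => -[<-] [<-].
- move=> i o h; have := run_bound h; rewrite /= addn2.
  case/split2=> A [a [b [C [sE iE]]]] h'; move: h h'; rewrite {}sE -{}iE /=.
  by rewrite !stepE /= ?stepE /=; case: a b => -[] //= [<-] [<-].
- move=> i o h [<-]; move: (run_bound h); rewrite /= addn2.
  case/split2=> A [a [b [C [sE iE]]]]; move: h; rewrite {}sE -{}iE /=.
  by rewrite !stepE /= ?stepE /= => -[<-].
- by move=> i pq pr qr _; apply: run_third.
- move=> i b h; have := run_bound h; rewrite /= addn0.
  case/split0=> A [C [sE iE]] h'; move: h h'; rewrite {}sE -{}iE /=.
  by rewrite !stepE /= ?stepE /= negbK => -[<-] [<-].
- move=> i h; have := run_bound h; rewrite /= addn2.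
  case/split2=> A [a [b [C [sE iE]]]] h'; move: h h'; rewrite {}sE -{}iE /=.
  by rewrite !stepE /= ?stepE /=; case: a b => -[] //= [<-] [<-].
- move=> i h [<-]; move: (run_bound h); rewrite /= addn2.
  case/split2=> A [a [b [C [sE iE]]]]; move: h; rewrite {}sE -{}iE /=.
  by rewrite !stepE /= ?stepE /= => -[<-].
- by move=> i; apply: run_third.
- by move=> i x y z _; apply: run_third.
Qed.

(** With parallel strands the two words coincide. Otherwise the third strand is pulled off the
    minimum on one side and off the maximum on the other, which leaves the same maximum below a
    minimum. *)
Lemma third_smooth0 A C a b c (f : fcrossing) : let i := size A in
  flat_local (A ++ [:: a, b, c & C]) (A ++ [:: c, b, a & C])
    (shadow (smoothing (A ++ [:: a, b, c & C]) i) ++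
       [:: (i.+1, Cross f); (i, Cross f)])
    ([:: (i.+1, Cross f); (i, Cross f)] ++
       shadow (smoothing (A ++ [:: c, a, b & C]) i.+1)).
Proof.
move=> i; rewrite /smoothing /i nth_cat0 nth_cat1 nth_cat1 nth_cat2.
case: eqP => [->|/eqP ab]; first by apply: floc_refl; rewrite /= !stepE.
have {ab} -> : b = ~~ a by case: a b ab => -[].
apply: (floc_trans (w := [:: (size A, Cap); ((size A).+1, Cup (~~ a))])).
  have := floc_cup_over A C c (~~ a) f; rewrite negbK => h.
  apply: (floc_prefix (a := [:: (size A, Cap)]) h).
  by rewrite /= stepE; case: (a).
apply/floc_sym; have h := floc_cap_over A C a c f.
apply: (floc_ctx (a := [::]) (b := [:: ((size A).+1, Cup (~~ a))]) h) => //.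
by rewrite /= stepE negbK.
Qed.

(** The middle crossing is smoothed. With parallel strands each side is a bigon, removed by a second
    move; otherwise one crossing slides through the maximum and the other through the minimum. *)
Lemma third_smooth1 A C a b c (f : fcrossing) : let i := size A in
  flat_local (A ++ [:: a, b, c & C]) (A ++ [:: c, b, a & C])
    ([:: (i, Cross f)] ++ shadow (smoothing (A ++ [:: b, a, c & C]) i.+1) ++
       [:: (i, Cross f)])
    ([:: (i.+1, Cross f)] ++ shadow (smoothing (A ++ [:: a, c, b & C]) i) ++
       [:: (i.+1, Cross f)]).
Proof.
move=> i; rewrite /smoothing /i nth_cat0 nth_cat1 nth_cat1 nth_cat2.
case: eqP => [->|/eqP ac] /=.
  apply: floc_trans (floc_double _ _ _ _ _) _.
  exact: floc_sym (floc_double1 _ _ _ _ _ _).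
have {ac} -> : c = ~~ a by case: a c ac => -[].
rewrite -/i.
apply: (floc_trans (w :=
  [:: (i.+1, Cross f); (i, Cap); (i.+1, Cup (~~ a)); (i, Cross f)])).
  apply: (floc_ctx (a := [::]) (b := [:: (i.+1, Cup (~~ a)); (i, Cross f)])
    (floc_sym (floc_cross_cap A a b C f))) => //.
  by rewrite /= stepE /= stepE negbK.
have := floc_sym (floc_cup_cross A b (~~ a) C f); rewrite negbK => h.
apply: (floc_prefix (a := [:: (i.+1, Cross f); (i, Cap)]) h).
by rewrite /= stepE /= stepE; case: (a).
Qed.

Lemma third_smooth2 A C a b c (f : fcrossing) : let i := size A in
  flat_local (A ++ [:: a, b, c & C]) (A ++ [:: c, b, a & C])
    ([:: (i, Cross f); (i.+1, Cross f)] ++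
       shadow (smoothing (A ++ [:: b, c, a & C]) i))
    (shadow (smoothing (A ++ [:: a, b, c & C]) i.+1) ++
       [:: (i, Cross f); (i.+1, Cross f)]).
Proof.
move=> i; rewrite /smoothing /i nth_cat0 nth_cat1 nth_cat1 nth_cat2.
case: eqP => [->|/eqP bc]; first by apply: floc_refl; rewrite /= !stepE.
have {bc} -> : c = ~~ b by case: b c bc => -[].
rewrite -/i.
apply: (floc_trans (w := [:: (i.+1, Cap); (i, Cup (~~ b))])).
  apply: (floc_ctx (a := [::]) (b := [:: (i, Cup (~~ b))])
    (floc_cap_over1 A C b a f)) => //.
  by rewrite /= stepE negbK.
apply/floc_sym; have := floc_cup_over1 A C a (~~ b) f; rewrite negbK => h.
apply: (floc_prefix (a := [:: (i.+1, Cap)]) h).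
by rewrite /= stepE; case: (b).
Qed.

(** Oddness covers both kinds of third move with a real crossing: once a real crossing is smoothed,
    the other two are both real or both virtual, hence have the same flat type. *)
Lemma third_smooth i x y z p q s t : odd (count is_real [:: x; y; z]) ->
  (p, q) \in third_corr -> real_crossing (third_lhs i x y z) p ->
  run s (third_lhs i x y z) = Some t -> run s (third_rhs i x y z) = Some t ->
  flat_local s t (shadow (smooth_from s (third_lhs i x y z) p))
    (shadow (smooth_from s (third_rhs i x y z) q)).
Proof.
move=> xyz pq rp hl /run_bound.
rewrite /= addn2 => /split3[A [a [b [c [C [sE iE]]]]]].
move: hl; rewrite {}sE -{}iE /= !stepE => -[<-].
move: pq rp; rewrite !inE => /or3P[] /eqP[-> ->]; rewrite /real_crossing /=;
  rewrite /smooth_from /= ?stepE /= ?shadow_cat => rp.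
- by case: x y z rp xyz => [o|] [oy|] [oz|] //= _ _; rewrite cats0;
    apply: third_smooth0.
- by case: y x z rp xyz => [o|] [oy|] [oz|] //= _ _; apply: third_smooth1.
- by case: z x y rp xyz => [o|] [oy|] [oz|] //= _ _; rewrite cats0;
    apply: third_smooth2.
Qed.

(** An antiparallel smoothing consists of two letters, and the distant letter [f] is exchanged with
    each in turn. *)
Lemma exchange_smooth_l (A B Q Q' C : seq bool) a b (f : elem fcrossing) :
  size Q = strands_in f -> step Q (0, f) = Some Q' ->
  let i := size A in let j := i + 2 + size B in
  flat_local (A ++ [:: a; b] ++ B ++ Q ++ C) (A ++ [:: b; a] ++ B ++ Q' ++ C)
    (shadow (smoothing (A ++ [:: a; b] ++ B ++ Q ++ C) i) ++ [:: (j, f)])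
    ([:: (j, f)] ++ shadow (smoothing (A ++ [:: a; b] ++ B ++ Q' ++ C) i)).
Proof.
move=> sQ fQ i j; rewrite /smoothing /i nth_cat0 nth_cat1 nth_cat0 nth_cat1 -/i.
case: eqP => [->|/eqP ab].
  apply: floc_refl; have -> : j = size (A ++ [:: b; b] ++ B).
    by rewrite !size_cat addnA.
  have E D : A ++ [:: b; b] ++ B ++ D = (A ++ [:: b; b] ++ B) ++ D.
    by rewrite -!catA.
  by rewrite !E /= (step_local _ _ sQ fQ).
have {ab} -> : b = ~~ a by case: a b ab => -[].
have aP : step [:: a; ~~ a] (0, Cap : elem fcrossing) = Some [::] by case: (a).
have aC : step [::] (0, Cup (~~ a) : elem fcrossing) = Some [:: ~~ a; a].
  by case: (a).
have h1 := @floc_exchange A [::] _ B _ _ C (Cup (~~ a)) f _ _ _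
  erefl aC sQ fQ erefl erefl erefl.
have h2 := @floc_exchange A [:: a; ~~ a] _ B _ _ C Cap f _ _ _
  erefl aP sQ fQ erefl erefl erefl.
apply: (floc_trans (w := [:: (i, Cap); (i + 0 + size B, f); (i, Cup (~~ a))])).
  apply: (floc_prefix (a := [:: (i, Cap)]) h1).
  by rewrite /= stepE; case: (a).
apply: (floc_ctx (a := [::]) (b := [:: (i, Cup (~~ a))]) h2) => //.
by rewrite /= stepE negbK.
Qed.

Lemma exchange_smooth_r (A P P' B C : seq bool) a b (e : elem fcrossing) :
  size P = strands_in e -> step P (0, e) = Some P' ->
  let i := size A in
  let j := i + strands_in e + size B in let j' := i + strands_out e + size B in
  flat_local (A ++ P ++ B ++ [:: a, b & C]) (A ++ P' ++ B ++ [:: b, a & C])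
    ([:: (i, e)] ++ shadow (smoothing (A ++ P' ++ B ++ [:: a, b & C]) j'))
    (shadow (smoothing (A ++ P ++ B ++ [:: a, b & C]) j) ++ [:: (i, e)]).
Proof.
move=> sP eP i j j'.
have sP' : size P' = strands_out e.
  by have := size_step eP; rewrite /= sP addnC => /addnI.
have jE : j = size (A ++ P ++ B) by rewrite !size_cat sP addnA.
have j'E : j' = size (A ++ P' ++ B) by rewrite !size_cat sP' addnA.
have E D : A ++ P ++ B ++ D = (A ++ P ++ B) ++ D by rewrite -!catA.
have E' D : A ++ P' ++ B ++ D = (A ++ P' ++ B) ++ D by rewrite -!catA.
have eA D : run (A ++ P ++ B ++ D) [:: (i, e)] = Some (A ++ P' ++ B ++ D).
  by rewrite /= (step_local _ _ sP eP).
have n0 x D : nth true (A ++ P ++ B ++ x :: D) j = x by rewrite E jE nth_cat0.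
have n1 x y D : nth true (A ++ P ++ B ++ [:: x, y & D]) j.+1 = y.
  by rewrite E jE nth_cat1.
have n0' x D : nth true (A ++ P' ++ B ++ x :: D) j' = x.
  by rewrite E' j'E nth_cat0.
have n1' x y D : nth true (A ++ P' ++ B ++ [:: x, y & D]) j'.+1 = y.
  by rewrite E' j'E nth_cat1.
rewrite /smoothing n0 n1 n0' n1'; case: eqP => [->|/eqP ab].
  by apply: floc_refl; rewrite cats0 eA.
have {ab} -> : b = ~~ a by case: a b ab => -[].
have aP : step [:: a; ~~ a] (0, Cap : elem fcrossing) = Some [::] by case: (a).
have aC : step [::] (0, Cup (~~ a) : elem fcrossing) = Some [:: ~~ a; a].
  by case: (a).
have h1 := @floc_exchange A _ _ B [:: a; ~~ a] _ C e Cap _ _ _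
  sP eP erefl aP erefl erefl erefl.
have h2 := @floc_exchange A _ _ B [::] _ C e (Cup (~~ a)) _ _ _
  sP eP erefl aC erefl erefl erefl.
apply: (floc_trans (w := [:: (j, Cap); (i, e); (j', Cup (~~ a))])).
  apply: (floc_ctx (a := [::]) (b := [:: (j', Cup (~~ a))]) h1) => //.
  by rewrite /= j'E E' stepE negbK E'.
apply: (floc_prefix (a := [:: (j, Cap)]) h2).
by rewrite /= jE E stepE; case: (a); rewrite /= -E.
Qed.

Lemma local_move_smooth k l r m p q s t : local_move k l r m ->
  (p, q) \in m -> real_crossing l p ->
  run s l = Some t -> run s r = Some t ->
  flat_local s t (shadow (smooth_from s l p)) (shadow (smooth_from s r q)).
Proof.
case=> {k l r m} //.
- move=> i j e f; rewrite !inE => /orP[] /eqP[-> ->]; rewrite /real_crossing /=.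
  + case: e => // -[o|//] _ /exchangeP[A [P [P' [B [Q [Q' [C]]]]]]].
    case=> -> -> [-> ->] [sP eP] [sQ fQ] _.
    case: P sP eP => [|a [|b [|//]]] // _; rewrite {1}/step /= => -[<-].
    have E D : A ++ [:: a, b & B ++ D] = (A ++ [:: a; b] ++ B) ++ D.
      by rewrite -!catA.
    have jE : size A + 2 + size B = size (A ++ [:: a; b] ++ B).
      by rewrite !size_cat addnA.
    rewrite /smooth_from /= jE {3}E (step_local _ _ sQ fQ) -jE -!catA.
    rewrite !shadow_cat cats0; apply: exchange_smooth_l.
      by rewrite strands_in_flatten.
    by rewrite step_flatten.
  + case: f => // -[o|//] _ /exchangeP[A [P [P' [B [Q [Q' [C]]]]]]].
    case=> -> -> [-> ->] [sP eP] [sQ fQ] _.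
    case: Q sQ fQ => [|a [|b [|//]]] // _; rewrite {1}/step /= => -[<-].
    rewrite /smooth_from /= (step_local _ _ sP eP) !shadow_cat.
    rewrite [shadow [::]]/= cats0 -strands_in_flatten -strands_out_flatten.
    apply: exchange_smooth_r; first by rewrite strands_in_flatten.
    by rewrite step_flatten.
- move=> i b x; rewrite inE => /eqP[-> ->] rx _ /[dup] /run_bound.
  rewrite /= addn0 => /split1[A [d [C [-> <-]]]].
  rewrite /smooth_from /= !stepE /= => -[<-].
  rewrite /smoothing nth_cat0 nth_cat1 nth_cat1 nth_cat2.
  (* Passing the extremum reverses the direction of one strand at the crossing as seen by the height
     function. Hence one side has the empty smoothing, and on the other the maximum and minimum form
     a zigzag with the given minimum. *)
  have [->|->] : d = b \/ d = ~~ b by case: b d rx => -[] _; auto.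
    rewrite eqxx; have -> : (~~ b == b) = false by case: (b).
    rewrite /=.
    apply: (floc_ctx (a := [::]) (b := [:: ((size A).+1, Cup b)])
      (floc_zigzag_r A b C)) => //.
    by rewrite /= stepE.
  rewrite eqxx; have -> : (~~ b == b) = false by case: (b).
  apply/floc_sym.
  have := floc_zigzag_l A (~~ b) C; rewrite negbK => h.
  apply: (floc_ctx (a := [::]) (b := [:: (size A, Cup b)]) h) => //.
  by rewrite /= stepE.
- move=> i x; rewrite inE => /eqP[-> ->] rx /[dup] /run_bound.
  rewrite /= addn2 => /split3[A [a [b [c [C [-> <-]]]]]].
  rewrite !stepE; case: ifP => // ac [<-] _; rewrite /smooth_from /=.
  have {ac} -> : c = ~~ a by case: a c ac => -[].
  rewrite /smoothing nth_cat0 nth_cat1 nth_cat2.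
  have [->|->] : b = a \/ b = ~~ a by case: a b => -[]; auto.
    rewrite eqxx; have -> : (a == ~~ a) = false by case: (a).
    have h := floc_zigzag_l A a C.
    apply: (floc_prefix (a := [:: ((size A).+1, Cap)]) h).
    by rewrite /= stepE; case: (a).
  rewrite eqxx; have -> : (a == ~~ a) = false by case: (a).
  apply/floc_sym.
  have h := floc_zigzag_r A (~~ a) C.
  apply: (floc_prefix (a := [:: (size A, Cap)]) h).
  by rewrite /= stepE; case: (a).
- by move=> i pq pr qr _ pq_in rp hl hr; apply: third_smooth.
- move=> i; rewrite !inE => /or3P[] /eqP[-> _]; by rewrite /real_crossing.
- by move=> i x y z xyz pq_in rp hl hr; apply: third_smooth => //;
     rewrite (eqP xyz).
Qed.

(** * Sliding a circle away *)

(* Insert two virtual crossings, turn them around the minimum, then pull the  *)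
(* maximum across. *)
Lemma circle_left (A C : seq bool) d b :
  flat_local (A ++ d :: C) (A ++ d :: C)
    [:: ((size A).+1, Cup b); ((size A).+1, Cap)]
    [:: (size A, Cup b); (size A, Cap)].
Proof.
set i := size A.
apply: (floc_trans (w := [:: (i.+1, Cup b); (i, Cross FVirtual);
  (i, Cross FVirtual); (i.+1, Cap)])).
  apply: (floc_ctx (a := [:: (i.+1, Cup b)]) (b := [:: (i.+1, Cap)])
    (floc_sym (floc_double A d b (~~ b :: C) FVirtual))).
    by rewrite /= stepE.
  by rewrite /= stepE; case: (b).
apply: (floc_trans (w := [:: (i, Cup b); (i.+1, Cross FVirtual);
  (i, Cross FVirtual); (i.+1, Cap)])).
  apply: (floc_ctx (a := [::]) (b := [:: (i, Cross FVirtual); (i.+1, Cap)])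
    (floc_sym (floc_cup_cross A d b C FVirtual))) => //.
  by rewrite /= stepE /= stepE; case: (b).
apply: (floc_ctx (a := [:: (i, Cup b)]) (b := [::])
  (s' := A ++ [:: b, ~~ b, d & C]) (t' := A ++ d :: C)
  (l := [:: (i.+1, Cross FVirtual); (i, Cross FVirtual); (i.+1, Cap)])
  (r := [:: (i, Cap)])) => //.
  exact: floc_cap_over.
by rewrite /= stepE.
Qed.

Definition circle i b : fword := [:: (i, Cup b); (i, Cap)].

Lemma run_circle s i b : i <= size s -> run s (circle i b) = Some s.
Proof.
by case/split0=> A [C [-> <-]]; rewrite /= step_cup /= step_cap; case: (b).
Qed.

Lemma circle_origin s i b : i <= size s ->
  flat_local s s (circle i b) (circle 0 b).
Proof.
elim: i => [|i IHi] lt_is; first by apply: floc_refl; rewrite run_circle.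
apply: floc_trans (IHi (ltnW lt_is)).
have [A [d [C [-> <-]]]] := split1 lt_is; exact: circle_left.
Qed.

(** To the left of all strands the circle is disjoint from every letter, so its minimum and maximum
    exchange with each. *)
Lemma circle_up s t w b : run s w = Some t ->
  flat_local s t (circle 0 b ++ w) (w ++ circle 0 b).
Proof.
elim: w s => [|[i f] w IHw] s /=.
  by move=> [<-]; apply: floc_refl; rewrite run_circle.
case h: (step s (i, f)) => [s'|//] rw.
have [A [Q [Q' [C [sE s'E iA sQ fQ]]]]] := stepP h.
apply: (floc_trans (w := [:: (0, Cup b); (i.+2, f); (0, Cap)] ++ w)).
  apply: (floc_ctx (a := [:: (0, Cup b)]) (b := w)
    (l := [:: (0, Cap); (i, f)]) (r := [:: (i.+2, f); (0, Cap)])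
    (s' := [:: b, ~~ b & s]) (t' := s')) => //.
  rewrite sE s'E; apply: (@floc_exchange [::] [:: b; ~~ b] [::] A Q Q' C) => //.
    by rewrite (step_cap _ [::] [::]); case: (b).
  by rewrite -iA.
  by rewrite /= /step /= take0 drop0.
apply: (floc_trans (w := [:: (i, f)] ++ circle 0 b ++ w)).
  apply: (floc_ctx (a := [::]) (b := (0, Cap) :: w)
    (l := [:: (0, Cup b); (i.+2, f)]) (r := [:: (i, f); (0, Cup b)])
    (s' := s) (t' := [:: b, ~~ b & s'])) => //.
    rewrite sE s'E.
    apply: (@floc_exchange [::] [::] [:: b; ~~ b] A Q Q' C) => //.
    by rewrite -iA.
  by rewrite /= /step /=; case: (b).
by apply: (floc_prefix (a := [:: (i, f)]) (IHw _ rw)); rewrite /= h.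
Qed.

(** A kink created at the maximum is absorbed by the minimum, which reverses the orientation of the
    minimum. *)
Lemma circle_reverse s b : flat_local s s (circle 0 b) (circle 0 (~~ b)).
Proof.
apply: (floc_trans (w := [:: (0, Cup b); (0, Cross Flat); (0, Cap)])).
  apply: (floc_ctx (a := [:: (0, Cup b)]) (b := [::]) (s' := [:: b, ~~ b & s])
    (floc_sym (floc_kink_cap [::] b s Flat))) => //.
  by rewrite /= /step /= take0 drop0.
apply: (floc_ctx (a := [::]) (b := [:: (0, Cap)])
    (floc_kink_cup [::] b s Flat)) => //=.
by rewrite /step /=; case: (b).
Qed.

Lemma circle_top s t i b w : i <= size s -> run s w = Some t ->
  flat_local s t (circle i b ++ w) (w ++ circle 0 true).
Proof.
move=> le_is rw; apply: (floc_trans (w := circle 0 true ++ w));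
  last exact: circle_up.
apply: (floc_ctx (a := [::]) (b := w) (l := circle i b) (r := circle 0 true)
  (s' := s) (t' := s)) => //.
apply: floc_trans (circle_origin b le_is) _.
by case: b; [apply/floc_refl/run_circle | apply: circle_reverse].
Qed.

(** * The chord index axioms *)

Lemma omega1_inv l r m : local_move Omega1 l r m ->
  (exists i b o, l = [:: (i, Cup b); (i, Cross (Real o))]) \/
  (exists i o, l = [:: (i, Cross (Real o)); (i, Cap)]).
Proof.
by move=> mv; inversion mv; [left; do 3!eexists | right; do 2!eexists].
Qed.

Lemma omega2_inv l r m : local_move Omega2 l r m ->
  r = [::] /\
  exists i o, l = [:: (i, Cross (Real o)); (i, Cross (Real (~~ o)))].
Proof. by move=> mv; inversion mv; split=> //; do 2!eexists. Qed.

Lemma omega3_inv l r m : local_move Omega3 l r m ->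
  exists i x y z, l = third_lhs i (Real x) (Real y) (Real z).
Proof. by move=> mv; inversion mv; do 4!eexists. Qed.

Lemma smooth_double i o s p q : p < 2 -> q < 2 ->
  let l := [:: (i, Cross (Real o)); (i, Cross (Real (~~ o)))] in
  run s l = Some s ->
  flat_local s s (shadow (smooth_from s l p)) (shadow (smooth_from s l q)).
Proof.
move=> lt_p2 lt_q2 l; have real_l c : c < 2 -> real_crossing l c.
  by case: c => [|[|]].
move=> /[dup] rl /run_bound.
rewrite /= addn2 => /split2[A [a [b [C [sE iE]]]]].
have h01 : flat_local s s (shadow (smooth_from s l 0))
    (shadow (smooth_from s l 1)).
  rewrite /l {rl real_l l}sE -{}iE /smooth_from /= stepE /smoothing.
  rewrite !(nth_cat0, nth_cat1); case: (eqVneq a b) => [->|ab].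
    by apply: floc_refl; rewrite /= stepE.
  have {ab} -> : b = ~~ a by case: a b ab => -[].
  (* The remaining crossing is a kink on the minimum in one smoothing and on the maximum in the
     other; both reduce to this word. *)
  apply: (floc_trans (w := [:: (size A, Cap); (size A, Cup a)])).
    have := floc_kink_cup A (~~ a) C Flat; rewrite negbK => h.
    apply: (floc_prefix (a := [:: (size A, Cap)]) h).
    by rewrite /= stepE; case: (a).
  apply/floc_sym.
  apply: (floc_ctx (a := [::]) (b := [:: (size A, Cup a)])
    (floc_kink_cap A a C Flat)) => //.
  by rewrite /= stepE.
have refl c : c < 2 -> flat_local s s (shadow (smooth_from s l c))
    (shadow (smooth_from s l c)).
  by move=> lt_c2; apply: floc_refl;
    rewrite run_shadow (run_smooth_from _ rl) ?real_l.
case: p q lt_p2 lt_q2 => [|[|//]] [|[|//]] _ _;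
  by [apply: refl | | apply: floc_sym].
Qed.

(** The legs of an extremum have opposite directions, so the smoothing is always a maximum below a
    minimum and splits off a circle. The upper context [post] is included because the circle has to
    travel through it to the top. *)
Lemma smooth_kink l r m s t post p : local_move Omega1 l r m ->
  real_crossing l p -> run s l = Some t -> run t post = Some [::] ->
  flat_local s [::] (shadow (smooth_from s l p) ++ shadow post)
    (shadow l ++ shadow post ++ circle 0 true).
Proof.
move=> mv rc; have [_ [_ [lt_p _ _]]] := real_crossingP rc; move: mv lt_p rc.
case/omega1_inv=> [[i [b [o ->]]]|[i [o ->]]]; case: p => [|[|//]] // _ _.
- move=> /[dup] /run_bound; rewrite /= addn0 => /split0[A [C [-> <-]]].
  rewrite !stepE => -[<-] rq.
  rewrite /smooth_from /= ?stepE /= /smoothing !(nth_cat0, nth_cat1).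
  have -> : (b == ~~ b) = false by case: (b).
  have rw : run (A ++ C) ((size A, Cup (~~ b)) :: shadow post) = Some [::].
    by rewrite /= stepE negbK run_shadow.
  apply: (floc_trans (w :=
    ((size A, Cup (~~ b)) :: shadow post) ++ circle 0 true)).
    by apply: circle_top rw; rewrite size_cat leq_addr.
  apply/floc_sym.
  apply: (floc_ctx (a := [::]) (b := shadow post ++ circle 0 true)
    (floc_kink_cup A b C Flat)) => //.
  by rewrite (run_cat (t := [::])) ?run_shadow.
- move=> /[dup] /run_bound; rewrite /= addn2 => /split2[A [a [b [C [-> <-]]]]].
  rewrite !stepE; case: ifP => // ab [<-] rq.
  have {ab} -> : b = ~~ a by case: a b ab => -[].
  rewrite /smooth_from /= /smoothing !(nth_cat0, nth_cat1).
  have -> : (a == ~~ a) = false by case: (a).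
  apply: (floc_trans (w := (size A, Cap) :: shadow post ++ circle 0 true)).
    apply: (floc_prefix (a := [:: (size A, Cap)])
      (l := circle (size A) (~~ a) ++ shadow post) (s' := A ++ C)).
      by apply: circle_top; rewrite ?run_shadow // size_cat leq_addr.
    by rewrite /= stepE; case: (a).
  apply/floc_sym.
  apply: (floc_ctx (a := [::]) (b := shadow post ++ circle 0 true)
    (floc_kink_cap A a C Flat)) => //.
  by rewrite (run_cat (t := [::])) ?run_shadow.
Qed.

(** * Moves and smoothings in context *)

Lemma validP M : valid M -> exists s t, [/\ run [::] (pre M) = Some s,
  run s (lhs M) = Some t, run s (rhs M) = Some t & run t (post M) = Some [::]].
Proof.
case=> mv /eqP/run_catP[s rp /run_catP[t rl rq]] /eqP; rewrite /target.
rewrite (run_cat _ rp) => /run_catP[t' rr rq']; exists s, t.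
by split=> //; rewrite (local_move_run mv rl rr).
Qed.

Lemma valid_context M p q s t :
  valid M -> run [::] (pre M) = Some s -> run s (lhs M) = Some t ->
  run [::] p = Some s -> run t q = Some [::] ->
  valid (Move (mkind M) p (lhs M) (rhs M) q (corr M)).
Proof.
move=> vM rp rl rp1 rq1; have [mv _ _] := vM; split=> //.
  by rewrite /diagram /source /= (run_cat _ rp1) (run_cat _ rl) rq1.
have [s' [t' []]] := validP vM; rewrite rp => -[<-]; rewrite rl => -[<-] rr _.
by rewrite /diagram /target /= (run_cat _ rp1) (run_cat _ rr) rq1.
Qed.

Lemma real_crossing_pre u v c : c < size u ->
  real_crossing (u ++ v) c = real_crossing u c.
Proof.
move=> lt_cu.
by rewrite /real_crossing !onthE map_cat nth_cat size_map lt_cu.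
Qed.

Lemma real_crossing_post u v c :
  real_crossing (u ++ v) (size u + c) = real_crossing v c.
Proof.
by rewrite /real_crossing !onthE map_cat nth_cat size_map ltnNge leq_addr addKn.
Qed.

Lemma local_move_corr k l r m p q :
  local_move k l r m -> (p, q) \in m -> p < size l /\ q < size r.
Proof.
case=> // [i j e f|i b x|i x|i x y z _|i|i x y z _]; rewrite !inE.
- by case/orP=> /eqP[-> ->].
- by case/eqP=> -> ->.
- by case/eqP=> -> ->.
all: by case/or3P=> /eqP[-> ->].
Qed.

Lemma index_corresponds M c c' : valid M -> real_crossing (source M) c ->
  corresponds M c c' ->
  flat_equiv (shadow_index (source M) c) (shadow_index (target M) c').
Proof.
move=> vM rc cc'; have [s [t [rp rl rr rq]]] := validP vM.
have [mv _ _] := vM.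
rewrite /shadow_index !smooth_fromE /source /target in rc *.
case: cc' rc => {c c'} [c lt_c|p q pq|j].
(* The crossing lies below the move: its smoothing keeps the state [s], so the same move applies
   above the smoothed context. *)
- rewrite real_crossing_pre // => rc; rewrite !smooth_from_pre //.
  have vM' := valid_context vM rp rl (run_smooth_from rc rp) rq.
  by apply: rst_step; eexists; split; first exact: vM'.
- have [lt_p lt_q] := local_move_corr mv pq.
  rewrite real_crossing_post real_crossing_pre // => rc.
  rewrite !(smooth_from_post _ _ rp) !smooth_from_pre //.
  rewrite !(shadow_cat (pre M)) !(shadow_cat _ (post M)).
  have [_ _] := local_move_smooth mv pq rc rl rr.
  by apply; rewrite run_shadow.
- rewrite -!addnA !real_crossing_post => rc.
  rewrite !(smooth_from_post _ _ rp) (smooth_from_post _ _ rl).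
  rewrite (smooth_from_post _ _ rr).
  have vM' := valid_context vM rp rl rp (run_smooth_from rc rq).
  by apply: rst_step; eexists; split; first exact: vM'.
Qed.

Lemma components_shadow w : components (shadow w) = components w.
Proof.
rewrite /components; elim: w ([::], 0, 0) => //= -[i e] w IHw t; rewrite -IHw.
by congr (foldl _ _ _).2; case: t => -[ls n] k; case: e => [||[]].
Qed.

Lemma shadow_index_components K c : knot K -> real_crossing K c ->
  diagram (shadow_index K c) /\ components (shadow_index K c) = 2.
Proof.
case/andP=> /eqP rK /eqP cK rc; split.
  by rewrite /diagram run_shadow smooth_fromE (run_smooth_from rc rK).
rewrite components_shadow /smooth.
have [i [o [_ -> KE]]] := real_crossingP rc.
move: rK cK; rewrite {1 2}KE => /run_catP[s rp rq].
by rewrite rp; apply: components_smoothing rp rq.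
Qed.

(** A circle above the whole diagram merely extends the upper context of each move. *)
Lemma add_circle_equiv K K' : virtual_equiv K K' ->
  flat_equiv (shadow K ++ circle 0 true) (shadow K' ++ circle 0 true).
Proof.
elim=> {K K'} [K K' [M [vM <- <-]]|K|K K' _|K K' K'' _ + _];
  [ | exact: rst_refl | exact: rst_sym | exact: rst_trans].
have [s [t [rp rl rr rq]]] := validP vM.
have rq' : run t (post M ++ lift (circle 0 true)) = Some [::].
  by rewrite (run_cat _ rq).
have vM' := valid_context vM rp rl rp rq'.
apply: rst_step; eexists; split; first exact: vM'.
  by rewrite /source /= !shadow_cat -!catA.
by rewrite /target /= !shadow_cat -!catA.
Qed.

Lemma involvedP M c : involved M c ->
  exists2 p, c = size (pre M) + p & p < size (lhs M).
Proof.
case/andP=> le_c lt_c; exists (c - size (pre M)); first by rewrite subnKC.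
by rewrite -(ltn_add2l (size (pre M))) subnKC.
Qed.

Theorem theorem3p9 :
  (forall (K : vword) (c : nat), knot K -> real_crossing K c ->
     diagram (shadow_index K c) /\ components (shadow_index K c) = 2) /\
  chord_index_axioms flat_equiv shadow_index.
Proof.
split; first exact: shadow_index_components.
split; try by move=> M c c' *; apply: index_corresponds.
(* The fixed index is the shadow of the knot with a split circle. *)
- exists (fun K => shadow K ++ circle 0 true); split.
    by move=> K K' _ _; apply: add_circle_equiv.
  move=> M c vM _ kM /involvedP[p -> lt_p].
  have [s [t [rp rl rr rq]]] := validP vM.
  rewrite /source real_crossing_post real_crossing_pre // => rc.
  rewrite /shadow_index smooth_fromE (smooth_from_post _ _ rp).
  rewrite smooth_from_pre //.
  have [mv _ _] := vM; rewrite kM in mv.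
  have [_ _ h] := smooth_kink mv rc rl rq.
  have := h (shadow (pre M)) [::]; rewrite !cats0 run_shadow.
  rewrite (shadow_cat (pre M)) (shadow_cat _ (post M)) => /(_ rp erefl).
  by rewrite !(shadow_cat (pre M)) (shadow_cat (lhs M)) -!catA.
- move=> M c c' vM _ kM /involvedP[p -> lt_p] /involvedP[q -> lt_q].
  have [s [t [rp rl rr rq]]] := validP vM.
  rewrite /shadow_index !smooth_fromE /source !(smooth_from_post _ _ rp).
  rewrite !smooth_from_pre //.
  rewrite !(shadow_cat (pre M)) !(shadow_cat _ (post M)).
  have [mv _ _] := vM; rewrite kM in mv.
  have [rE [i [o lE]]] := omega2_inv mv.
  move: rr; rewrite {}rE /= => -[stE]; move: rl lt_p lt_q.
  rewrite {}lE -{}stE in rq *.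
  move=> rl lt_p lt_q; have [_ _] := smooth_double lt_p lt_q rl.
  by apply; rewrite run_shadow.
(* It remains to see that the crossing is real, which holds for every letter of an [Omega3] side. *)
- move=> M c c' vM _ kM inv cc'; apply: index_corresponds => //.
  have [p -> lt_p] := involvedP inv.
  rewrite /source real_crossing_post real_crossing_pre //.
  have [mv _ _] := vM; rewrite kM in mv.
  have [i [x [y [z lE]]]] := omega3_inv mv.
  by move: lt_p; rewrite lE; case: p => [|[|[|]]].
Qed.
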